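(* Assume Assumption A and that all $\mu_{i,j}$ have finite support. Let $\mathcal F\mu(z)$, $z\in(\mathbb C^* )^d$, be the $p\times p$ matrix with entries $\sum_{x\in\mathbb Z^d}z^x\mu_{i,j}(x)$, where $z^x=\prod_{k}z_k^{x_k}$; let $P(z)=\det(I_p-\mathcal F\mu(z))$, $\mathscr C=\{z\in(\mathbb C^* )^d:P(z)=0\}$, and let $A(\mathscr C)=\{(\log|z_1|,\dots,\log|z_d|):z\in\mathscr C\}\subset\mathbb R^d$ be its amoeba. Then the origin lies in the complement of $A(\mathscr C)$, the closure of the connected component of $\mathbb R^d\setminus A(\mathscr C)$ containing the origin is the set $\mathcal T=\{t\in\mathbb R^d:\rho(t)\le1\}$, and the limit curve of the sandpile $\mathcal C=\{\frac{u}{\Gamma^{-1}(u)\cdot u}:u\in\mathbb S^{d-1}\}$ is the dual curve of the boundary of this component.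
   Context: Setting. $d,p\ge1$ are integers. For $x\in\mathbb Z^d$, $i,j\in\{1,\dots,p\}$ let $c(x,i,j)\ge 0$, with $0<\sigma_i:=\sum_{(y,j)}c(y,i,j)<\infty$, and let $m_i\ge1$ be leakiness parameters. Put $\mu_{i,j}(x)=\frac{c(x,i,j)}{m_i\sigma_i}$. The killed random walk (KRW) $(X_n)$ on $(\mathbb Z^d\times\{1,\dots,p\})\sqcup\{\mathsf k\}$ jumps from $(x,i)$ to $(y,j)$ with probability $\mu_{i,j}(y-x)$ and from $(x,i)$ to the absorbing cemetery $\mathsf k$ with probability $1-\frac1{m_i}$. Assumption A: (1) $m_i>1$ for at least one $i$; (2) the KRW is irreducible: every $(x,j)$ can be reached from every $(0,i)$ with positive probability in some number $n\ge1$ of steps; (3) it is aperiodic: $\gcd\{n\ge1:\mathbb P_{(x,i)}(X_n=(x,i))>0\}=1$ for all $(x,i)$; (4) $\sum_{x}e^{\gamma\|x\|}\mu_{i,j}(x)<\infty$ for all $i,j$ and all $\gamma>0$. For $t\in\mathbb R^d$ let $L\mu(t)$ be the $p\times p$ matrix with entries $\sum_{x\in\mathbb Z^d}e^{t\cdot x}\mu_{i,j}(x)$ and $\rho(t)$ its spectral radius; $\mathcal T=\{t:\rho(t)\le1\}$ is compact convex with $0$ in its interior, and $\partial\mathcal T=\{t:\rho(t)=1\}$. The map $\Gamma:\partial\mathcal T\to\mathbb S^{d-1}$, $\Gamma(t)=\nabla\rho(t)/\|\nabla\rho(t)\|$, is a homeomorphism (known result), and $\Gamma^{-1}(u)\cdot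 u>0$ for all $u$. Dual curve. For $K\subset\mathbb R^d$ compact convex with $0$ in its interior and $x\in\partial K$, let $N_K(x)=\{n\in\mathbb R^d: n\cdot(y-x)\le0\ \forall y\in K\}$ and $x^*=\{z\in N_K(x): z\cdot x=1\}$. The dual curve of $\partial K$ is $(\partial K)^*=\bigcup_{x\in\partial K}x^*$. *)

(* Defs.v *)
From HB Require Import structures.
From mathcomp Require Import all_boot all_order all_algebra.
From mathcomp Require Import all_classical all_reals all_analysis.
From mathcomp Require Import complex.

Set Implicit Arguments.
Unset Strict Implicit.
Unset Printing Implicit Defensive.

Import Order.TTheory GRing.Theory Num.Theory.
Import numFieldNormedType.Exports.

Local Open Scope classical_set_scope.
Local Open Scope ring_scope.

(* Euclidean structure on R^d. The library norm on 'rV[R]_d is the max norm: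
   it is only used through the topology it induces. *)
Definition dotv (R : realType) (d : nat) (u v : 'rV[R]_d) : R :=
  \sum_(k < d) u 0 k * v 0 k.

Definition eucl_norm (R : realType) (d : nat) (u : 'rV[R]_d) : R :=
  Num.sqrt (dotv u u).

Definition unit_sphere (R : realType) (d : nat) : set 'rV[R]_d :=
  [set u | eucl_norm u = 1].

Definition frontier (T : topologicalType) (A : set T) : set T :=
  closure A `\` A°.

Definition gradient (R : realType) (d : nat) (f : 'rV[R]_d -> R)
    (t : 'rV[R]_d) : 'rV[R]_d :=
  \row_(k < d) derive f t (delta_mx 0 k).

Definition real_of_Zd (R : realType) (d : nat) (x : 'rV[int]_d) : 'rV[R]_d :=
  map_mx intr x.

Definition spectral_radius (R : realType) (p : nat) (A : 'M[R]_p) : R :=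
  sup [set Normc.normc l | l in
        [set l : complex R | eigenvalue (map_mx (real_complex R) A) l]].

Definition is_gcd (S : set nat) (g : nat) : Prop :=
  (forall n, S n -> (g %| n)%N) /\
  (forall h, (forall n, S n -> (h %| n)%N) -> (h %| g)%N).

(* The killed random walk. States are [Some (x, i)] for (x, i) in
   Z^d x {1, ..., p} (the latter indexed by 'I_p), and [None] for the
   cemetery. *)
Section KilledRandomWalk.
Context (R : realType) (d p : nat).
Context (c : 'rV[int]_d -> 'I_p -> 'I_p -> R) (m : 'I_p -> R).

Definition sigma (i : 'I_p) : \bar R :=
  \esum_(y in [set: 'rV[int]_d]) (\sum_(j < p) c y i j)%:E.

Definition mu (i j : 'I_p) (x : 'rV[int]_d) : R :=
  c x i j / (m i * fine (sigma i)).

Local Notation krw_state := (option ('rV[int]_d * 'I_p)%type).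

Definition krw_step (a b : krw_state) : R :=
  match a, b with
  | Some (x, i), Some (y, j) => mu i j (y - x)
  | Some (_, i), None => 1 - (m i)^-1
  | None, Some _ => 0
  | None, None => 1
  end.

(* krw_prob n a b is the probability P_a(X_n = b), given by the
   Chapman-Kolmogorov recursion on the first step. *)
Fixpoint krw_prob (n : nat) (a b : krw_state) : \bar R :=
  match n with
  | 0 => ((a == b)%:R)%:E
  | n'.+1 => \esum_(w in [set: krw_state])
               ((krw_step a w)%:E * krw_prob n' w b)%E
  end.

Definition krw_irreducible : Prop :=
  forall (i j : 'I_p) (x : 'rV[int]_d),
    exists2 n, (1 <= n)%N & (0 < krw_prob n (Some (0%R, i)) (Some (x, j)))%E.

Definition krw_aperiodic : Prop :=
  forall (x : 'rV[int]_d) (i : 'I_p),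
    is_gcd [set n | (1 <= n)%N /\
                    (0 < krw_prob n (Some (x, i)) (Some (x, i)))%E] 1.

Definition exponential_moments : Prop :=
  forall (i j : 'I_p) (g : R), 0 < g ->
    (\esum_(x in [set: 'rV[int]_d])
       (expR (g * eucl_norm (real_of_Zd R x)) * mu i j x)%:E < +oo)%E.

Definition assumptionA : Prop :=
  [/\ exists i, 1 < m i, krw_irreducible, krw_aperiodic & exponential_moments].

Definition Lmu (t : 'rV[R]_d) : 'M[R]_p :=
  \matrix_(i < p, j < p)
    fine (\esum_(x in [set: 'rV[int]_d])
            (expR (dotv t (real_of_Zd R x)) * mu i j x)%:E).

Definition rho (t : 'rV[R]_d) : R := spectral_radius (Lmu t).

Definition setTau : set 'rV[R]_d := [set t | rho t <= 1].

Definition Gamma (t : 'rV[R]_d) : 'rV[R]_d :=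
  (eucl_norm (gradient rho t))^-1 *: gradient rho t.

(* The inverse of Gamma, seen as a map from the frontier of setTau to the unit
   sphere. *)
Definition Gamma_inv : 'rV[R]_d -> 'rV[R]_d :=
  'pinv_(fun=> 0) (frontier setTau) Gamma.

Definition limit_curve : set 'rV[R]_d :=
  [set (dotv (Gamma_inv u) u)^-1 *: u | u in @unit_sphere R d].

Definition monomial (z : 'rV[complex R]_d) (x : 'rV[int]_d) : complex R :=
  \prod_(k < d) z 0 k ^ x 0 k.

(* The sum is the finitely supported one: it is the intended series when
   mu i j has finite support and z has no zero coordinate. *)
Definition Fmu (z : 'rV[complex R]_d) : 'M[complex R]_p :=
  \matrix_(i < p, j < p)
    \sum_(x \in [set: 'rV[int]_d]) monomial z x * real_complex R (mu i j x).

Definition charP (z : 'rV[complex R]_d) : complex R := \det (1%:M - Fmu z).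

Definition zero_locus : set 'rV[complex R]_d :=
  [set z : 'rV[complex R]_d | (forall k, z 0 k != 0) /\ charP z = 0].

Definition amoeba : set 'rV[R]_d :=
  [set \row_(k < d) ln (Normc.normc ((z : 'rV[complex R]_d) 0 k))
     | z in zero_locus].

Definition origin_component : set 'rV[R]_d :=
  connected_component (~` amoeba) 0.

End KilledRandomWalk.

Section DualCurve.
Context (R : realType) (d : nat).
Implicit Types K S Z : set 'rV[R]_d.

Definition normal_cone K (x : 'rV[R]_d) : set 'rV[R]_d :=
  [set n | forall y, K y -> dotv n (y - x) <= 0].

Definition dual_points K (x : 'rV[R]_d) : set 'rV[R]_d :=
  [set z | normal_cone K x z /\ dotv z x = 1].

(* Z is the dual curve of S, where S is the boundary of a compact convex set K
   with 0 in its interior. Such a K, being the convex hull of its boundary, is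
   determined by S, and hence so is Z. *)
Definition is_dual_curve S Z : Prop :=
  exists K, [/\ compact K, convex_set (K : set (convex_lmodType 'rV[R]_d)),
                K° 0, frontier K = S
              & Z = \bigcup_(x in S) dual_points K x].

End DualCurve.

(* Main.v *)
Require Import Defs.
From HB Require Import structures.
From mathcomp Require Import all_boot all_order all_algebra.
From mathcomp Require Import all_classical all_reals all_analysis.
From mathcomp Require Import complex.
From mathcomp Require Import ring lra.

(** A finitely supported KRW makes [Lmu t] an irreducible nonnegative matrix whose
    entries are exponential sums, and [rho t] is its Perron root. Everything
    follows from the Collatz-Wielandt bounds: a positive [w] with [A w <= lam w]
    gives [rho <= lam], and likewise for [>=] and the strict inequalities. Testing
    them on Perron vectors at a nearby point shows that [{rho < k}] and
    [{rho > k}] are open; on the geometric mean of two Perron vectors, that [rho]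
    is convex; on a first-order corrected Perron vector, that [rho] has
    directional derivatives [h |-> grad . h]. Closed paths of the walk through
    [+- e_k] make [{rho <= 1}] bounded.

    On the torus over [t] one has [|Fmu z| <= Lmu t] entrywise, so the amoeba
    avoids [{rho < 1}], while [z = e^t] puts [{rho = 1}] in it; hence the
    component of the origin is [{rho < 1}]. At a point [x] of its frontier
    convexity gives [grad . x > 0] and identifies the normal cone with the ray of
    [grad], so the dual points of [x] reduce to [u / (u . x)] with
    [u = Gamma x]. *)

Set Implicit Arguments.
Unset Strict Implicit.
Unset Printing Implicit Defensive.

Import Order.TTheory GRing.Theory Num.Theory.
Import numFieldNormedType.Exports.

Local Open Scope classical_set_scope.
Local Open Scope ring_scope.

(** * Perron-Frobenius theory *)

Definition nneg_mx (R : realType) m n (A : 'M[R]_(m, n)) :=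
  forall i j, 0 <= A i j.

Definition pos_mx (R : realType) m n (A : 'M[R]_(m, n)) :=
  forall i j, 0 < A i j.

(** The exponent [k] depends on the entry and may be [0], so the condition is automatic on the
    diagonal. *)
Definition irreducible_mx (R : realType) n (A : 'M[R]_n.+1) :=
  nneg_mx A /\ forall i j, exists k, 0 < (A ^+ k) i j.

Section NonnegativeMatrices.
Context (R : realType).

Lemma pos_nneg m n (A : 'M[R]_(m, n)) : pos_mx A -> nneg_mx A.
Proof. by move=> A0 i j; exact: ltW. Qed.

Lemma nneg_mulmx m n k (A : 'M[R]_(m, n)) (B : 'M[R]_(n, k)) :
  nneg_mx A -> nneg_mx B -> nneg_mx (A *m B).
Proof. by move=> A0 B0 i j; rewrite mxE sumr_ge0// => l _; rewrite mulr_ge0. Qed.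

Lemma mulmx_nneg_pos_gt0 m n k (A : 'M[R]_(m, n)) (B : 'M[R]_(n, k)) i j l :
  nneg_mx A -> nneg_mx B -> 0 < A i l -> 0 < B l j -> 0 < (A *m B) i j.
Proof.
move=> A0 B0 Ail Blj; rewrite mxE (bigD1 l)//= ltr_pwDl ?mulr_gt0//.
by rewrite sumr_ge0// => q _; rewrite mulr_ge0.
Qed.

Lemma neq0_entry m n (A : 'M[R]_(m, n)) : A != 0 -> exists i j, A i j != 0.
Proof.
move=> A0; apply: contrapT => H; case/negP: A0; apply/eqP/matrixP => i j.
by rewrite mxE; apply/eqP; apply: contrapT => /negP Aij; apply: H; exists i, j.
Qed.

Lemma nneg_mulmx_pos m n k (A : 'M[R]_(m, n)) (B : 'M[R]_(n, k)) i :
  nneg_mx A -> pos_mx B -> (exists l, A i l != 0) -> forall j, 0 < (A *m B) i j.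
Proof.
move=> A0 B0 [l Ail] j; apply: (@mulmx_nneg_pos_gt0 _ _ _ _ _ _ _ l) => //.
  exact: pos_nneg.
by rewrite lt_neqAle eq_sym Ail A0.
Qed.

Lemma nneg_expr n (A : 'M[R]_n.+1) k : nneg_mx A -> nneg_mx (A ^+ k).
Proof.
move=> A0; elim: k => [|k IH]; first by move=> i j; rewrite expr0 mxE ler0n.
by rewrite exprS; exact: nneg_mulmx.
Qed.

Lemma trmx_exp n (A : 'M[R]_n.+1) k : (A ^+ k)^T = A^T ^+ k.
Proof.
elim: k => [|k IH]; first by rewrite !expr0 trmx1.
by rewrite exprSr exprS trmx_mul IH.
Qed.

Lemma irreducible_trmx n (A : 'M[R]_n.+1) :
  irreducible_mx A -> irreducible_mx A^T.
Proof.
move=> [A0 irrA]; split=> [i j|i j]; first by rewrite mxE.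
by have [k Ak] := irrA j i; exists k; rewrite -trmx_exp mxE.
Qed.

(** Add up one power of [A] per pair [(i, j)], chosen positive at that entry: the sum is positive
    everywhere and, being a polynomial in [A], commutes with it. *)
Lemma irreducible_commuting_pos n (A : 'M[R]_n.+1) : irreducible_mx A ->
  exists2 N : 'M[R]_n.+1, pos_mx N & A *m N = N *m A.
Proof.
move=> [A0 irrA].
have [f fP] : exists f : 'I_n.+1 -> 'I_n.+1 -> nat,
    forall i j, 0 < (A ^+ f i j) i j.
  have /choice[f fP] : forall ij : 'I_n.+1 * 'I_n.+1, exists k,
      0 < (A ^+ k) ij.1 ij.2 by move=> [i j]; exact: irrA.
  by exists (fun i j => f (i, j)) => i j; exact: (fP (i, j)).
exists (\sum_i \sum_j A ^+ f i j) => [i j|].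
  rewrite summxE (bigD1 i)//= ltr_pwDl//.
    rewrite summxE (bigD1 j)//= ltr_pwDl//.
    by rewrite sumr_ge0// => q _; exact: nneg_expr.
  by rewrite sumr_ge0// => q _; rewrite summxE sumr_ge0// => s _; exact: nneg_expr.
rewrite mulmx_sumr mulmx_suml; apply: eq_bigr => i _.
rewrite mulmx_sumr mulmx_suml; apply: eq_bigr => j _.
by rewrite -[LHS]exprS exprSr.
Qed.

(* Compactness supplies a pair with x in the simplex, x A >= lam x and lam
   maximal. If x A <> lam x, a positive N commuting with A turns the
   inequality into a strict one for x N, contradicting maximality. *)
Lemma perron_row n (A : 'M[R]_n.+1) : irreducible_mx A ->
  exists (lam : R) (l : 'rV[R]_n.+1), pos_mx l /\ l *m A = lam *: l.
Proof.
move=> irrA; have [A0 _] := irrA.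
have [N N0 AN] := irreducible_commuting_pos irrA.
(* An a priori bound: summing [lam x <= x A] over the coordinates of a point of the simplex gives
   [lam <= B]. *)
pose B := \sum_i \sum_j A i j.
pose box : set ('rV[R]_n.+1 * R) :=
  [set v : 'rV[R]_n.+1 | forall i, `[0, 1]%classic (v 0 i)] `*` `[0, B]%classic.
pose K : set ('rV[R]_n.+1 * R) := box `&`
  ([set z : 'rV[R]_n.+1 * R | \sum_j z.1 0 j = 1] `&`
   \bigcap_(i in [set: 'I_n.+1]) [set z : 'rV[R]_n.+1 * R |
     0 <= (z.1 *m A) 0 i - z.2 * z.1 0 i]).
have coord_cont i : continuous (fun z : 'rV[R]_n.+1 * R => z.1 0 i).
  move=> z; apply: (@continuous_comp _ _ _ fst (fun v : 'rV[R]_n.+1 => v 0 i)).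
    exact: cvg_fst.
  exact: coord_continuous.
have sum_cont (F : 'I_n.+1 -> 'rV[R]_n.+1 * R -> R) :
    (forall i, continuous (F i)) -> continuous (fun z => \sum_i F i z).
  by move=> Fc; apply: (continuous_big add_continuous).
have K_compact : compact K.
  apply: compact_closedI.
    apply: compact_setX; last exact: segment_compact.
    have := @rV_compact R n.+1 (fun=> `[0, 1]%classic).
    by apply=> i; exact: segment_compact.
  apply: closedI.
    apply: (@closed_comp _ _ (fun z : 'rV[R]_n.+1 * R => \sum_j z.1 0 j)
      [set x | x = 1]); last exact: closed_eq.
    by move=> z _; exact: sum_cont.
  apply: closed_bigI => i _.
  apply: (@closed_comp _ _
    (fun z : 'rV[R]_n.+1 * R => (z.1 *m A) 0 i - z.2 * z.1 0 i)
    [set x | 0 <= x]); last exact: closed_ge.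
  move=> z _; apply: (@continuousB _ _ _ (fun z : 'rV[R]_n.+1 * R => (z.1 *m A) 0 i)).
    rewrite (_ : (fun z : 'rV[R]_n.+1 * R => (z.1 *m A) 0 i) =
      (fun z => \sum_j z.1 0 j * A j i)); last by apply/funext => y; rewrite mxE.
    apply: sum_cont => j y; apply: continuousM; first exact: coord_cont.
    exact: cst_continuous.
  apply: continuousM; last exact: coord_cont.
  exact: cvg_snd.
(* Used twice: with [lam = 0] to see that [K] is nonempty, and with [lam + e] to contradict
   maximality. *)
have normalize (x : 'rV[R]_n.+1) (lam : R) : nneg_mx x -> x != 0 -> 0 <= lam ->
    (forall i, lam * x 0 i <= (x *m A) 0 i) ->
    K ((\sum_j x 0 j)^-1 *: x, lam).
  move=> x0 xN0 lam0 xA.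
  have [i [j xij]] := neq0_entry xN0; rewrite ord1 in xij.
  have sx : 0 < \sum_j x 0 j.
    rewrite (bigD1 j)//= ltr_pwDl ?sumr_ge0// lt_neqAle eq_sym xij; exact: x0.
  have y0 k : 0 <= ((\sum_j x 0 j)^-1 *: x) 0 k.
    by rewrite mxE mulr_ge0// invr_ge0 ltW.
  have y1 : \sum_k ((\sum_j x 0 j)^-1 *: x) 0 k = 1.
    by under eq_bigr do rewrite mxE; rewrite -mulr_sumr mulVf// gt_eqF.
  have yA k : lam * ((\sum_j x 0 j)^-1 *: x) 0 k <= ((\sum_j x 0 j)^-1 *: x *m A) 0 k.
    by rewrite -scalemxAl !mxE mulrCA ler_pM2l ?invr_gt0//; have := xA k; rewrite mxE.
  move: (_ *: _) y0 y1 yA => {x0 xN0 xA xij sx} y y0 y1 yA.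
  have yle1 k : y 0 k <= 1.
    by rewrite -y1 (bigD1 k)//= lerDl sumr_ge0.
  split; first split => /=.
  - by move=> k; rewrite /= in_itv/= y0 yle1.
  - rewrite in_itv/= lam0/= -[lam]mulr1 -y1 mulr_sumr.
    apply: (le_trans (ler_sum _ (fun k _ => yA k))).
    under eq_bigr do rewrite mxE.
    rewrite exchange_big/=; apply: ler_sum => k _; apply: ler_sum => q _.
    by rewrite ler_piMl.
  - by split => //= k _ /=; rewrite subr_ge0.
have [z zK zmax] : exists2 z, z \in K & forall y, y \in K -> y.2 <= z.2.
  apply: compact_EVT_max => //.
    exists ((\sum_j (const_mx 1 : 'rV[R]_n.+1) 0 j)^-1 *: const_mx 1, 0).
    apply: normalize => //.
    + by move=> i j; rewrite mxE.
    + by apply/eqP => /matrixP/(_ 0 0)/eqP; rewrite !mxE oner_eq0.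
    + move=> i; rewrite mul0r; apply: nneg_mulmx => // k l; by rewrite mxE.
  by apply: continuous_subspaceT => y; exact: cvg_snd.
case: z zK zmax => x lam /set_mem [[/= xbox lamB] [/= x1 xA]] zmax.
have x0 : nneg_mx x.
  by move=> i j; rewrite ord1; have := xbox j; rewrite in_itv => /andP[].
have lam0 : 0 <= lam by move: lamB; rewrite /= in_itv => /andP[].
have xN0 : exists l, x 0 l != 0.
  apply: contrapT => H; move/eqP: x1; rewrite big1 => [|i _].
    by rewrite eq_sym oner_eq0.
  by apply/eqP; apply: contrapT => /negP xi; apply: H; exists i.
have subZE (u w : 'rV[R]_n.+1) k : (u - lam *: w) 0 k = u 0 k - lam * w 0 k.
  by rewrite !mxE.
pose y := x *m A - lam *: x.
have y0 : nneg_mx y.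
  by move=> i j; rewrite ord1 /y subZE; exact: (xA j I).
have xN : pos_mx (x *m N) by move=> i; rewrite ord1; exact: nneg_mulmx_pos.
have xNE : x *m N *m A - lam *: (x *m N) = y *m N.
  by rewrite /y mulmxBl -!mulmxA AN -scalemxAl.
exists lam, (x *m N); split=> //; apply/eqP; rewrite -subr_eq0 xNE.
have [->|/neq0_entry[i [j yij]]] := eqVneq y 0; first by rewrite mul0mx.
exfalso.
rewrite ord1 {i} in yij.
have yN i : 0 < (y *m N) 0 i by apply: nneg_mulmx_pos => //; exists j.
(* The least ratio of the slack [y N] to [x N], capped at the default [1]: raising [lam] by [e]
   keeps [x N] admissible. *)
pose e := \big[Order.min/1]_i ((y *m N) 0 i / (x *m N) 0 i).
have e0 : 0 < e.
  by apply: lt_bigmin => // i _; rewrite divr_gt0//; exact: xN.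
have /mem_set/zmax/= : K ((\sum_j (x *m N) 0 j)^-1 *: (x *m N), lam + e).
  apply: normalize.
  - exact: pos_nneg.
  - by apply/eqP => /matrixP/(_ 0 0)/eqP; rewrite [X in _ == X]mxE gt_eqF.
  - by rewrite addr_ge0// ltW.
  - move=> i; rewrite mulrDl -lerBrDl.
    have -> : (x *m N *m A) 0 i - lam * (x *m N) 0 i = (y *m N) 0 i.
      by rewrite -xNE subZE.
    by rewrite -ler_pdivlMr; [exact: bigmin_le|exact: xN].
by rewrite gerDl leNgt e0.
Qed.

End NonnegativeMatrices.

(** * Perron root, spectral radius and Collatz-Wielandt bounds *)

Section SpectralRadius.
Context (R : realType).
Local Notation normc := Normc.normc.

(** The right eigenvector comes from the transpose. Computing [l A r] in two ways identifies the two
    eigenvalues, since [l r > 0]. *)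
Lemma perron n (A : 'M[R]_n.+1) : irreducible_mx A ->
  exists (lam : R) (l : 'rV[R]_n.+1) (r : 'cV[R]_n.+1),
    [/\ pos_mx l, pos_mx r, l *m A = lam *: l & A *m r = lam *: r].
Proof.
move=> irrA.
have [lam [l [l0 lA]]] := perron_row irrA.
have [lam' [r [r0 rA]]] := perron_row (irreducible_trmx irrA).
have r0' : pos_mx r^T by move=> i j; rewrite mxE.
have rA' : A *m r^T = lam' *: r^T by rewrite -[A]trmxK -trmx_mul rA linearZ.
exists lam, l, r^T; split => //; rewrite rA'; congr (_ *: _).
have lr : 0 < (l *m r^T) 0 0.
  by apply: (mulmx_nneg_pos_gt0 (l := 0)) => //; exact: pos_nneg.
have : l *m (A *m r^T) = l *m A *m r^T by rewrite mulmxA.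
rewrite rA' lA -scalemxAr -scalemxAl => /matrixP/(_ 0 0).
by rewrite [LHS]mxE [RHS]mxE; apply: mulIf; rewrite gt_eqF.
Qed.

Lemma normc_sum (I : Type) (s : seq I) (P : pred I) (F : I -> R[i]) :
  normc (\sum_(i <- s | P i) F i) <= \sum_(i <- s | P i) normc (F i).
Proof.
elim/big_ind2 : _ => [|x a y b xa yb|//]; first by rewrite Normc.normc0.
by rewrite (le_trans (le_normcD _ _))// lerD.
Qed.

Lemma normc_real (x : R) : normc (real_complex R x) = `|x|.
Proof. by rewrite /normc /= expr0n addr0 sqrtr_sqr. Qed.

Lemma normc_ge0 (x : R[i]) : 0 <= normc x.
Proof. by case: x => a b; rewrite /normc sqrtr_ge0. Qed.

(* Pairing |v| |z| <= |v| A with the positive right eigenvector r. *)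
Lemma normc_eigenvalue_le n (A : 'M[R]_n) (r : 'cV[R]_n) (lam : R)
    (B : 'M[R[i]]_n) (v : 'rV[R[i]]_n) (z : R[i]) :
  pos_mx r -> A *m r = lam *: r -> (forall i j, normc (B i j) <= A i j) ->
  v != 0 -> v *m B = z *: v -> normc z <= lam.
Proof.
move=> r0 Ar BA v0 vB.
pose s := \sum_j normc (v 0 j) * r j 0.
have [j vj] : exists j, v 0 j != 0.
  apply: contrapT => H; case/negP: v0; apply/eqP/matrixP => i j.
  by rewrite mxE ord1; apply/eqP; apply: contrapT => /negP vj; apply: H; exists j.
have s0 : 0 < s.
  rewrite /s (bigD1 j)//= ltr_pwDl//.
    rewrite mulr_gt0// lt_neqAle normc_ge0 andbT eq_sym.
    by apply: contra vj => /eqP /Normc.eq0_normc ->.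
  by rewrite sumr_ge0// => k _; rewrite mulr_ge0 ?normc_ge0// ltW.
rewrite -(ler_pM2r s0) /s mulr_sumr.
have -> : lam * (\sum_j normc (v 0 j) * r j 0) =
    \sum_j (\sum_i normc (v 0 i) * A i j) * r j 0.
  rewrite mulr_sumr; under [RHS]eq_bigr do rewrite mulr_suml.
  rewrite exchange_big/=; apply: eq_bigr => i _.
  have /matrixP/(_ i 0) := Ar; rewrite !mxE => Ari.
  rewrite mulrCA -Ari mulr_sumr; apply: eq_bigr => k _; by rewrite mulrA.
apply: ler_sum => i _; rewrite mulrA ler_pM2r// -Normc.normcM.
have /matrixP/(_ 0 i) := vB; rewrite !mxE => <-.
rewrite (le_trans (normc_sum _ _ _))//; apply: ler_sum => k _.
by rewrite Normc.normcM ler_wpM2l// normc_ge0.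
Qed.

(** The vector [l] exhibits [lam] as an eigenvalue, so the supremum is over a nonempty set; pairing
    with [r] bounds the modulus of every eigenvalue by [lam]. *)
Lemma spectral_radiusE n (A : 'M[R]_n.+1) (l : 'rV[R]_n.+1) (r : 'cV[R]_n.+1)
    (lam : R) : nneg_mx A -> pos_mx l -> pos_mx r ->
  l *m A = lam *: l -> A *m r = lam *: r -> spectral_radius A = lam.
Proof.
move=> A0 l0 r0 lA rA.
have lam0 : 0 <= lam.
  rewrite -(pmulr_lge0 _ (l0 0 0)).
  have /matrixP/(_ 0 0) := lA; rewrite [RHS]mxE => <-.
  by apply: nneg_mulmx => //; exact: pos_nneg.
have lamE : [set l0 : R[i] | eigenvalue (map_mx (real_complex R) A) l0]
    (real_complex R lam).
  apply/eigenvalueP; exists (map_mx (real_complex R) l).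
    by rewrite -map_mxM lA map_mxZ.
  apply/eqP => /matrixP/(_ 0 0); rewrite !mxE => -[] H.
  by have := l0 0 0; rewrite H ltxx.
have ub : ubound [set normc l0 | l0 in
    [set l0 : R[i] | eigenvalue (map_mx (real_complex R) A) l0]] lam.
  move=> _ [z /= /eigenvalueP[v vA v0] <-].
  apply: (normc_eigenvalue_le r0 rA _ v0 vA) => i j.
  by rewrite mxE normc_real ger0_norm.
apply/eqP; rewrite eq_le; apply/andP; split.
  by apply: ge_sup => //; exists (normc (real_complex R lam)), (real_complex R lam).
apply: ub_le_sup; first by exists lam.
by exists (real_complex R lam); rewrite ?normc_real ?ger0_norm.
Qed.

Lemma perron_frobenius n (A : 'M[R]_n.+1) : irreducible_mx A ->
  exists (l : 'rV[R]_n.+1) (r : 'cV[R]_n.+1),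
    [/\ pos_mx l, pos_mx r, l *m A = spectral_radius A *: l
      & A *m r = spectral_radius A *: r].
Proof.
move=> irrA; have [lam [l [r [l0 r0 lA rA]]]] := perron irrA.
have [A0 _] := irrA.
by rewrite (spectral_radiusE A0 l0 r0 lA rA); exists l, r.
Qed.

Lemma mulmx_row_pos_le n (l : 'rV[R]_n) (u w : 'cV[R]_n) :
  pos_mx l -> (forall i, u i 0 <= w i 0) -> (l *m u) 0 0 <= (l *m w) 0 0.
Proof. by move=> l0 uw; rewrite !mxE ler_sum// => i _; rewrite ler_pM2l. Qed.

Lemma mulmx_row_pos_lt n (l : 'rV[R]_n.+1) (u w : 'cV[R]_n.+1) :
  pos_mx l -> (forall i, u i 0 <= w i 0) -> (exists i, u i 0 < w i 0) ->
  (l *m u) 0 0 < (l *m w) 0 0.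
Proof.
move=> l0 uw [i uwi]; rewrite !mxE (bigD1 i)//= [ltRHS](bigD1 i)//=.
by rewrite ltr_leD ?ltr_pM2l// ler_sum// => j _; rewrite ler_pM2l.
Qed.

Section CollatzWielandt.
Context (n : nat) (A : 'M[R]_n.+1) (w : 'cV[R]_n.+1) (lam : R).
Context (irrA : irreducible_mx A) (w0 : pos_mx w).

(** Multiplying by the left Perron vector replaces [A w] by [rho w], so coordinatewise comparisons
    of [A w] with [lam w] become comparisons of [rho] with [lam]. *)
Let pairing : exists2 l : 'rV[R]_n.+1, pos_mx l &
  0 < (l *m w) 0 0 /\ (l *m (A *m w)) 0 0 = spectral_radius A * (l *m w) 0 0.
Proof.
have [l [_ [l0 _ lA _]]] := perron_frobenius irrA.
exists l => //; split; last by rewrite mulmxA lA -scalemxAl mxE.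
by apply: (mulmx_nneg_pos_gt0 (l := 0)) => //; exact: pos_nneg.
Qed.

Let scaleE (l : 'rV[R]_n.+1) : (l *m (lam *: w)) 0 0 = lam * (l *m w) 0 0.
Proof. by rewrite -scalemxAr mxE. Qed.

Lemma collatz_wielandt_le :
  (forall i, (A *m w) i 0 <= lam * w i 0) -> spectral_radius A <= lam.
Proof.
have [l l0 [lw lAw]] := pairing => H.
rewrite -(ler_pM2r lw) -lAw -scaleE; apply: mulmx_row_pos_le => // i.
by rewrite [leRHS]mxE.
Qed.

Lemma collatz_wielandt_ge :
  (forall i, lam * w i 0 <= (A *m w) i 0) -> lam <= spectral_radius A.
Proof.
have [l l0 [lw lAw]] := pairing => H.
rewrite -(ler_pM2r lw) -lAw -scaleE; apply: mulmx_row_pos_le => // i.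
by rewrite [leLHS]mxE.
Qed.

Lemma collatz_wielandt_lt : (forall i, (A *m w) i 0 <= lam * w i 0) ->
  (exists i, (A *m w) i 0 < lam * w i 0) -> spectral_radius A < lam.
Proof.
have [l l0 [lw lAw]] := pairing => H [j Hj].
rewrite -(ltr_pM2r lw) -lAw -scaleE; apply: mulmx_row_pos_lt => // [i|].
  by rewrite [leRHS]mxE.
by exists j; rewrite [ltRHS]mxE.
Qed.

Lemma collatz_wielandt_gt : (forall i, lam * w i 0 <= (A *m w) i 0) ->
  (exists i, lam * w i 0 < (A *m w) i 0) -> lam < spectral_radius A.
Proof.
have [l l0 [lw lAw]] := pairing => H [j Hj].
rewrite -(ltr_pM2r lw) -lAw -scaleE; apply: mulmx_row_pos_lt => // [i|].
  by rewrite [leLHS]mxE.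
by exists j; rewrite [ltLHS]mxE.
Qed.

End CollatzWielandt.

(* Subtracting from x the largest multiple of l that keeps it nonnegative
   leaves a nonnegative eigenvector with a zero entry, which must vanish. *)
Lemma perron_simple n (A : 'M[R]_n.+1) (l x : 'rV[R]_n.+1) (lam : R) :
  irreducible_mx A -> pos_mx l -> l *m A = lam *: l -> x *m A = lam *: x ->
  exists a, x = a *: l.
Proof.
move=> irrA l0 lA xA.
have [i0 _ i0P] : exists2 i0 : 'I_n.+1, true & forall i,
    x 0 i0 / l 0 i0 <= x 0 i / l 0 i.
  have [i _ H] := @arg_minP _ R 'I_n.+1 0 xpredT (fun i => x 0 i / l 0 i) isT.
  by exists i => // k; exact: H.
pose a := x 0 i0 / l 0 i0.
exists a; apply/eqP; rewrite -subr_eq0; apply/negPn/negP => /neq0_entry[i [j]].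
rewrite ord1 {i} => yj.
pose y := x - a *: l.
have y0 : nneg_mx y.
  move=> i k; rewrite ord1 !mxE subr_ge0 -ler_pdivlMr//; exact: i0P.
have yA k : y *m A ^+ k = lam ^+ k *: y.
  elim: k => [|k IH]; first by rewrite !expr0 mulmx1 scale1r.
  rewrite [A ^+ k.+1]exprSr mulmxA IH -scalemxAl.
  have -> : y *m A = lam *: y.
    by rewrite /y mulmxBl -scalemxAl lA xA scalerBr !scalerA mulrC.
  by rewrite scalerA exprSr.
(* A power of [A] that leads from [j] to [i0] makes entry [i0] of [y A^k] positive, whereas
   [y A^k = lam^k y] vanishes there. *)
have [A0 /(_ j i0)[k Ak]] := irrA.
have := yA k => /matrixP/(_ 0 i0); rewrite [RHS]mxE.
have -> : y 0 i0 = 0 by rewrite !mxE /a divfK ?subrr// gt_eqF.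
rewrite mulr0 => /eqP; rewrite gt_eqF//.
apply: (mulmx_nneg_pos_gt0 (l := j)) => //; first exact: nneg_expr.
by rewrite lt_neqAle eq_sym yj; exact: y0.
Qed.

(** Fredholm alternative. The columns of the cokernel of [B] are, transposed, left eigenvectors of
    [A] for [lam], hence multiples of [l] by [perron_simple], and [b] is orthogonal to [l]. *)
Lemma perron_solvable n (A : 'M[R]_n.+1) (l : 'rV[R]_n.+1) (b : 'cV[R]_n.+1)
    (lam : R) : irreducible_mx A -> pos_mx l -> l *m A = lam *: l ->
  l *m b = 0 -> exists v : 'cV[R]_n.+1, lam *: v - A *m v = b.
Proof.
move=> irrA l0 lA lb.
pose B := (lam%:M - A)^T.
suff : (b^T <= B)%MS.
  move=> /submxP[v bE]; exists v^T; rewrite -[b]trmxK bE /B trmx_mul trmxK.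
  by rewrite mulmxBl mul_scalar_mx.
rewrite submxE; apply/eqP/matrixP => i j; rewrite ord1.
have : (cokermx B)^T *m (lam%:M - A) = 0.
  by rewrite -[lam%:M - A]trmxK -trmx_mul mulmx_coker trmx0.
move=> /(congr1 (row j)); rewrite row_mul row0 mulmxBr => /eqP.
rewrite subr_eq0 mul_mx_scalar eq_sym => /eqP /(perron_simple irrA l0 lA) [a cE].
have /matrixP/(_ 0 0) : a *: (l *m b) = 0 by rewrite lb scaler0.
rewrite scalemxAl -cE !mxE => E; rewrite -[RHS]E; apply: eq_bigr => k _.
by rewrite !mxE mulrC.
Qed.

End SpectralRadius.

(** * The transform of the killed random walk *)

Section Dot.
Context (R : realType) (d : nat).
Implicit Types u v w : 'rV[R]_d.

Lemma dotvC u v : dotv u v = dotv v u.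
Proof. by apply: eq_bigr => i _; rewrite mulrC. Qed.

Lemma dotvDl u v w : dotv (u + v) w = dotv u w + dotv v w.
Proof. by rewrite /dotv -big_split; apply: eq_bigr => i _; rewrite mxE mulrDl. Qed.

Lemma dotvZl a u w : dotv (a *: u) w = a * dotv u w.
Proof. by rewrite /dotv mulr_sumr; apply: eq_bigr => i _; rewrite mxE mulrA. Qed.

Lemma dotvDr u v w : dotv w (u + v) = dotv w u + dotv w v.
Proof. by rewrite dotvC dotvDl !(dotvC w). Qed.

Lemma dotvZr a u w : dotv w (a *: u) = a * dotv w u.
Proof. by rewrite dotvC dotvZl (dotvC w). Qed.

Lemma dotvNl u w : dotv (- u) w = - dotv u w.
Proof. by rewrite -scaleN1r dotvZl mulN1r. Qed.

Lemma dotvNr u w : dotv w (- u) = - dotv w u.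
Proof. by rewrite dotvC dotvNl dotvC. Qed.

Lemma dotv0 u : dotv u 0 = 0.
Proof. by rewrite -(scale0r 0) dotvZr mul0r. Qed.

Lemma dot0v u : dotv 0 u = 0.
Proof. by rewrite dotvC dotv0. Qed.

Lemma dotv_ge0 u : 0 <= dotv u u.
Proof. by rewrite /dotv sumr_ge0// => i _; rewrite -expr2 sqr_ge0. Qed.

Lemma dotv_eq0 u : dotv u u = 0 -> u = 0.
Proof.
move=> /eqP; rewrite psumr_eq0; last by move=> i _; rewrite -expr2 sqr_ge0.
move=> /allP u0; apply/matrixP => i j; rewrite ord1 [RHS]mxE.
by have := u0 j (mem_index_enum _); rewrite mulf_eq0 orbb => /eqP.
Qed.

Lemma dotv_delta u k : dotv u (delta_mx 0 k) = u 0 k.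
Proof.
rewrite /dotv (bigD1 k)//= mxE !eqxx mulr1 big1 ?addr0// => i ik.
by rewrite mxE eqxx (negbTE ik) mulr0.
Qed.

Lemma dotv_cont w : continuous (fun u => dotv u w).
Proof.
apply: (continuous_big add_continuous) => i _ u.
by apply: continuousM; [exact: coord_continuous|exact: cst_continuous].
Qed.

End Dot.

Lemma real_of_ZdD (R : realType) d (x y : 'rV[int]_d) :
  real_of_Zd R (x + y) = real_of_Zd R x + real_of_Zd R y.
Proof. by apply/matrixP => i j; rewrite !mxE rmorphD. Qed.

Section KilledRandomWalkTransform.
Context (R : realType) (d n : nat).
Context (c : 'rV[int]_d -> 'I_n.+1 -> 'I_n.+1 -> R) (m : 'I_n.+1 -> R).
Context (hc : forall x i j, 0 <= c x i j).
Context (hsigma : forall i, (0 < sigma c i < +oo)%E).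
Context (hm : forall i, 1 <= m i).
Context (hfin : forall i j, finite_set [set x | mu c m i j x != 0]).

Let m_gt0 i : 0 < m i.
Proof. exact: lt_le_trans (hm i). Qed.

Let sigma_fin i : sigma c i = (fine (sigma c i))%:E.
Proof.
by have /andP[s0 s1] := hsigma i; rewrite fineK// fin_real// s1 (lt_trans _ s0).
Qed.

Let sigma_gt0 i : 0 < fine (sigma c i).
Proof. by have /andP[s0 s1] := hsigma i; rewrite fine_gt0// s0 s1. Qed.

Lemma mu_ge0 i j x : 0 <= mu c m i j x.
Proof. by rewrite /mu divr_ge0// mulr_ge0// ltW. Qed.

(** One support common to all pairs of types makes every entry of the transform a finite sum over
    the same list. *)
Lemma mu_support : exists2 s : seq 'rV[int]_d, uniq s &
  forall i j x, mu c m i j x != 0 -> x \in s.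
Proof.
have fU : finite_set (\bigcup_(ij in [set: 'I_n.+1 * 'I_n.+1])
    [set x | mu c m ij.1 ij.2 x != 0]).
  by apply: bigcup_finite => // ij _; exact: hfin.
exists (finmap.enum_fset (fset_set (\bigcup_(ij in [set: 'I_n.+1 * 'I_n.+1])
    [set x | mu c m ij.1 ij.2 x != 0]))); first exact: finmap.fset_uniq.
by move=> i j x muN0; rewrite in_fset_set// inE; exists (i, j).
Qed.

Context (s : seq 'rV[int]_d) (us : uniq s).
Context (hs : forall i j x, mu c m i j x != 0 -> x \in s).

Lemma esum_support (F : 'rV[int]_d -> R) : (forall x, 0 <= F x) ->
  (forall x, F x != 0 -> x \in s) ->
  (\esum_(x in [set: 'rV[int]_d]) (F x)%:E = (\sum_(x <- s) F x)%:E)%E.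
Proof.
move=> F0 Fs.
have -> : (\esum_(x in [set: 'rV[int]_d]) (F x)%:E =
    \esum_(x in [set` s]) (F x)%:E)%E.
  rewrite [RHS]esum_mkcond; apply: eq_esum => x _.
  case: ifPn => // /negP xs; have [->//|/Fs xs'] := eqVneq (F x) 0.
  by exfalso; apply: xs; rewrite inE.
rewrite esum_fset//=; last by move=> x _; rewrite lee_fin.
by rewrite -fsbig_seq// sumEFin.
Qed.

Lemma LmuE t i j :
  Lmu c m t i j = \sum_(x <- s) expR (dotv t (real_of_Zd R x)) * mu c m i j x.
Proof.
rewrite mxE esum_support//= => x; first by rewrite mulr_ge0 ?expR_ge0 ?mu_ge0.
by rewrite mulf_eq0 negb_or => /andP[_]; exact: hs.
Qed.

Lemma Lmu_ge0 t : nneg_mx (Lmu c m t).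
Proof.
by move=> i j; rewrite LmuE sumr_ge0// => x _; rewrite mulr_ge0 ?expR_ge0 ?mu_ge0.
Qed.

Lemma Lmu_ge_term t i j x :
  expR (dotv t (real_of_Zd R x)) * mu c m i j x <= Lmu c m t i j.
Proof.
have [->|muN0] := eqVneq (mu c m i j x) 0; first by rewrite mulr0 Lmu_ge0.
have xs := hs muN0.
rewrite LmuE (perm_big _ (perm_to_rem xs)) big_cons lerDl.
by rewrite sumr_ge0// => y _; rewrite mulr_ge0 ?expR_ge0 ?mu_ge0.
Qed.

(** The row sum is the probability of surviving one step; it is bounded by comparing a partial sum
    of [sigma] with the whole. *)
Lemma Lmu0_row_le i : \sum_j Lmu c m 0 i j <= (m i)^-1.
Proof.
under eq_bigr do rewrite LmuE.
rewrite exchange_big/=.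
under eq_bigr => x _.
  under eq_bigr => j _ do rewrite dot0v expR0 mul1r /mu.
  rewrite -mulr_suml; over.
rewrite -mulr_suml invfM mulrCA ger_pMr ?invr_gt0// ler_pdivrMr// mul1r.
rewrite -lee_fin -sigma_fin /sigma; apply: esum_ge; exists [set` s].
  by split => //; exact: finite_seq.
by rewrite -fsbig_seq// sumEFin.
Qed.

Lemma krw_step_ge0 a b : 0 <= krw_step c m a b.
Proof.
case: a b => [[x i]|] [[y j]|] //=; first exact: mu_ge0.
by rewrite subr_ge0 invf_le1.
Qed.

Lemma krw_prob_ge0 k a b : (0 <= krw_prob c m k a b)%E.
Proof.
elim: k a => [|k IH] a /=; first by rewrite lee_fin ler0n.
by apply: esum_ge0 => w _; rewrite mule_ge0// lee_fin krw_step_ge0.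
Qed.

Lemma krw_probS_gt0 k a b : (0 < krw_prob c m k.+1 a b)%E ->
  exists2 w, 0 < krw_step c m a w & (0 < krw_prob c m k w b)%E.
Proof.
move=> H; apply: contrapT => Hn; move: H => /=.
rewrite esum1 ?ltxx// => w _.
have := krw_step_ge0 a w; rewrite le_eqVlt => /orP[/eqP <-|st0].
  by rewrite mul0e.
have := krw_prob_ge0 k w b; rewrite le_eqVlt => /orP[/eqP <-|pr0].
  by rewrite mule0.
by exfalso; apply: Hn; exists w.
Qed.

Lemma krw_prob_cemetery k y : krw_prob c m k None (Some y) = 0%E.
Proof.
elim: k => [//|k IH] /=; rewrite esum1// => -[w _|_]; first by rewrite /= mul0e.
by rewrite IH mule0.
Qed.

(** Follow one path of positive probability: [q] is the product of its jump weights, the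
    exponentials of its jumps multiply to that of the total displacement, and the path is one term
    of the matrix power. Thus [q] does not depend on [t]. *)
Lemma krw_path k x i y j : (0 < krw_prob c m k (Some (x, i)) (Some (y, j)))%E ->
  exists2 q, 0 < q & forall t,
    q * expR (dotv t (real_of_Zd R (y - x))) <= (Lmu c m t ^+ k) i j.
Proof.
elim: k x i => [|k IH] x i.
  rewrite /= lte_fin ltr0n lt0b => /eqP [-> ->]; exists 1 => // t.
  by rewrite subrr expr0 mxE eqxx /real_of_Zd map_mx0 dotv0 expR0 mulr1.
move=> /krw_probS_gt0[[[z l] /= mu0 /IH[q q0 qP]|]]; last first.
  by rewrite krw_prob_cemetery ltxx.
exists (mu c m i l (z - x) * q) => [|t]; first by rewrite mulr_gt0.
rewrite (_ : y - x = (z - x) + (y - z)); last by rewrite [RHS]addrC subrKA.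
rewrite real_of_ZdD dotvDr expRD mulrACA exprS mxE (bigD1 l)//=.
rewrite -[leLHS]addr0 lerD// ?ler_pM//.
- by rewrite mulr_ge0 ?expR_ge0 ?mu_ge0.
- by rewrite mulr_ge0 ?expR_ge0// ltW.
- by rewrite mulrC Lmu_ge_term.
- rewrite sumr_ge0// => l' _; rewrite mulr_ge0 ?Lmu_ge0//.
  exact/nneg_expr/Lmu_ge0.
Qed.

Context (hirr : krw_irreducible c m).

Lemma Lmu_irreducible t : irreducible_mx (Lmu c m t).
Proof.
split=> [|i j]; first exact: Lmu_ge0.
have [k _ /krw_path[q q0 qP]] := hirr i j 0.
by exists k; rewrite (lt_le_trans _ (qP t))// mulr_gt0 ?expR_gt0.
Qed.

(** Returns to type [i] with arbitrary displacement make a diagonal entry grow exponentially in any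
    prescribed lattice direction; this is what bounds the sublevel set of [rho]. *)
Lemma Lmu_diag_ge i x : exists k, exists2 q, 0 < q & forall t,
  q * expR (dotv t (real_of_Zd R x)) <= (Lmu c m t ^+ k) i i.
Proof.
have [k _ /krw_path[q q0 qP]] := hirr i i x.
by exists k, q => // t; have := qP t; rewrite subr0.
Qed.

End KilledRandomWalkTransform.

(** * The Perron root of a family of exponential sums *)

(** Average the tangent-line inequalities at the intermediate point [C], where the linear terms
    cancel. *)
Lemma expR_convex (R : realType) (k A B : R) : 0 <= k -> k <= 1 ->
  expR ((1 - k) * A + k * B) <= (1 - k) * expR A + k * expR B.
Proof.
move=> k0 k1; set C := (1 - k) * A + k * B.
have tangent x : expR C * (1 + (x - C)) <= expR x.
  have -> : expR x = expR C * expR (x - C) by rewrite -expRD addrC subrK.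
  by rewrite ler_pM2l ?expR_gt0// expR_ge1Dx.
rewrite (_ : expR C =
  (1 - k) * (expR C * (1 + (A - C))) + k * (expR C * (1 + (B - C)))).
  by rewrite lerD// ler_wpM2l// subr_ge0.
by rewrite /C; ring.
Qed.

Lemma is_derive_bigsum (R : realType) (I : Type) (s : seq I) (F : I -> R -> R)
    (D : I -> R) (x : R) : (forall i, is_derive x 1 (F i) (D i)) ->
  is_derive x 1 (fun y => \sum_(i <- s) F i y) (\sum_(i <- s) D i).
Proof.
move=> FD; elim: s => [|i s IH].
  rewrite big_nil (_ : (fun _ => _) = cst 0); first exact: is_derive_cst.
  by apply/funext => y; rewrite big_nil.
rewrite big_cons (_ : (fun y => _) = F i + (fun y => \sum_(j <- s) F j y)).
  exact: is_deriveD.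
by apply/funext => y; rewrite big_cons.
Qed.

Section ExponentialFamily.
Context (R : realType) (d n : nat) (s : seq 'rV[int]_d).
Context (a : 'I_n.+1 -> 'I_n.+1 -> 'rV[int]_d -> R) (M : 'rV[R]_d -> 'M[R]_n.+1).
Context (a_ge0 : forall i j x, 0 <= a i j x).
Context (ME : forall t i j,
  M t i j = \sum_(x <- s) expR (dotv t (real_of_Zd R x)) * a i j x).
Context (Mirr : forall t, irreducible_mx (M t)).

Local Notation rho t := (spectral_radius (M t)).

Lemma expfam_rho_convex x y k : 0 <= k -> k <= 1 ->
  rho ((1 - k) *: x + k *: y) <= (1 - k) * rho x + k * rho y.
Proof.
move=> k0 k1.
have [_ [r1 [_ r10 _ Mr1]]] := perron_frobenius (Mirr x).
have [_ [r2 [_ r20 _ Mr2]]] := perron_frobenius (Mirr y).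
pose w : 'cV[R]_n.+1 :=
  \col_i expR ((1 - k) * ln (r1 i 0) + k * ln (r2 i 0)).
apply: (@collatz_wielandt_le _ _ _ w) => [//|i j|i].
  by rewrite mxE expR_gt0.
(* Dividing row [i] of the eigenvalue equation by [r i 0] and absorbing the ratios into the
   exponents leaves exponentials of functions affine in [t] and in the logarithms of [r], to which
   [expR_convex] applies term by term. *)
have rowE (t : 'rV[R]_d) (r : 'cV[R]_n.+1) : pos_mx r ->
    M t *m r = rho t *: r ->
    \sum_j \sum_(z <- s)
      expR (dotv t (real_of_Zd R z) + ln (r j 0) - ln (r i 0)) * a i j z = rho t.
  move=> r0 /matrixP/(_ i 0); rewrite [RHS]mxE mxE => E.
  apply: (@mulIf _ (r i 0)); first by rewrite gt_eqF.
  rewrite -E mulr_suml; apply: eq_bigr => j _; rewrite ME !mulr_suml.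
  apply: eq_bigr => z _.
  rewrite expRD expRD expRN !lnK ?posrE//.
  rewrite mulrAC divfK ?gt_eqF// [in RHS]mulrAC; congr (_ * _).
rewrite -(rowE x r1 r10 Mr1) -(rowE y r2 r20 Mr2) !mxE !mulr_sumr.
rewrite -big_split/= mulr_suml; apply: ler_sum => j _.
rewrite ME !mulr_sumr -big_split/= !mulr_suml; apply: ler_sum => z _.
rewrite mxE !mulrA -mulrDl mulrAC [leRHS]mulrAC ler_wpM2r//.
set A := _ + _ - _; set B := _ + _ - _.
rewrite -ler_pdivrMr ?expR_gt0// -expRN -!expRD.
apply: le_trans (expR_convex A B k0 k1); rewrite ler_expR le_eqVlt; apply/orP; left.
by apply/eqP; rewrite /A /B dotvDl !dotvZl; ring.
Qed.

Lemma expfam_mulmx_cont (w : 'cV[R]_n.+1) i : continuous (fun t => (M t *m w) i 0).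
Proof.
rewrite (_ : (fun t => _) = fun t => \sum_j
    (\sum_(x <- s) expR (dotv t (real_of_Zd R x)) * a i j x) * w j 0); last first.
  by apply/funext => t; rewrite mxE; apply: eq_bigr => j _; rewrite ME.
have contMr (f : 'rV[R]_d -> R) (k : R) :
    continuous f -> continuous (fun t => f t * k).
  move=> fc t; apply: (@continuousM _ _ f (cst k)); first exact: fc.
  exact: cst_continuous.
apply: (continuous_big add_continuous) => j _; apply: (contMr _ _).
apply: (continuous_big add_continuous) => x _; apply: contMr => t.
apply: (@continuous_comp _ _ _ (fun t => dotv t (real_of_Zd R x)) (@expR R)).
  exact: dotv_cont.
exact: continuous_expR.
Qed.

Lemma expfam_rho_lt_open k : open [set t | rho t < k].
Proof.
rewrite openE => t /= tk.
have [_ [r [_ r0 _ Mr]]] := perron_frobenius (Mirr t).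
(* With the test vector frozen at [t], these are finitely many strict inequalities, each stable by
   continuity of [M]. *)
have H : \forall u \near t, forall i, (M u *m r) i 0 < k * r i 0.
  apply: (@filter_forall _ 'I_n.+1 (fun i u => (M u *m r) i 0 < k * r i 0)
    (nbhs t) (nbhs_filter t)) => i.
  have := cvgr_lt _ (@expfam_mulmx_cont r i t) (k * r i 0). apply.
  by rewrite Mr mxE ltr_pM2r.
rewrite /interior; near=> u; rewrite /=.
have ur i : (M u *m r) i 0 < k * r i 0 by move: i; near: u.
by apply: (collatz_wielandt_lt (Mirr u) r0); [move=> i; exact: ltW|exists 0].
Unshelve. all: by end_near. Qed.

Lemma expfam_rho_gt_open k : open [set t | k < rho t].
Proof.
rewrite openE => t /= tk.
have [_ [r [_ r0 _ Mr]]] := perron_frobenius (Mirr t).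
have H : \forall u \near t, forall i, k * r i 0 < (M u *m r) i 0.
  apply: (@filter_forall _ 'I_n.+1 (fun i u => k * r i 0 < (M u *m r) i 0)
    (nbhs t) (nbhs_filter t)) => i.
  have := cvgr_gt _ (@expfam_mulmx_cont r i t) (k * r i 0). apply.
  by rewrite Mr mxE ltr_pM2r.
rewrite /interior; near=> u; rewrite /=.
have ur i : k * r i 0 < (M u *m r) i 0 by move: i; near: u.
by apply: (collatz_wielandt_gt (Mirr u) r0); [move=> i; exact: ltW|exists 0].
Unshelve. all: by end_near. Qed.

Lemma expfam_rho_ge0 t : 0 <= rho t.
Proof.
have [M0 _] := Mirr t; apply: (@collatz_wielandt_ge _ _ _ (const_mx 1)) => //.
  by move=> i j; rewrite mxE.
by move=> i; rewrite mul0r; apply: nneg_mulmx => // k l; rewrite mxE.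
Qed.

(** The derivative of [M] at [x] in the direction [h], taken term by term. *)
Definition expfam_dmx (x h : 'rV[R]_d) : 'M[R]_n.+1 := \matrix_(i, j) \sum_(z <- s)
  dotv h (real_of_Zd R z) * expR (dotv x (real_of_Zd R z)) * a i j z.

Lemma expfam_is_derive x h i j :
  is_derive (0 : R) 1 (fun e : R => M (e *: h + x) i j) (expfam_dmx x h i j).
Proof.
rewrite mxE (_ : (fun e => _) = fun e : R => \sum_(z <- s)
    expR (e * dotv h (real_of_Zd R z) + dotv x (real_of_Zd R z)) * a i j z).
  apply: is_derive_bigsum => z.
  set b := dotv h _; set c := dotv x _.
  have D1 : is_derive (0 : R) 1 (fun e : R => e * b + c) b.
    rewrite (_ : (fun e => _) = (b \*: id) + cst c).
      by apply: is_derive_eq; rewrite addr0 [LHS]mulr1.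
    by apply/funext => e; rewrite /= mulrC.
  have D2 : is_derive (0 : R) 1 (fun e : R => expR (e * b + c)) (b * expR c).
    have := @is_derive1_comp _ expR (fun e : R => e * b + c) _ _ _
        (is_derive_expR _) D1.
    by rewrite mul0r add0r mulrC.
  rewrite (_ : (fun e => _) = a i j z \*: (fun e : R => expR (e * b + c))).
    by apply: is_derive_eq; rewrite [LHS]mulrC.
  by apply/funext => e; rewrite /= [RHS]mulrC.
apply/funext => e; rewrite ME; apply: eq_bigr => z _.
by rewrite dotvDl dotvZl.
Qed.

End ExponentialFamily.

(** Differentiability as a first-order estimate, the form that Collatz-Wielandt bounds produce. The
    limit is punctured, so [k = 0] is treated apart. *)
Lemma is_derive_near (R : realType) (V : normedModType R) (f : V -> R) (x h : V)
    (D e : R) : is_derive x h f D -> 0 < e ->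
  \forall k \near (0 : R), `|f (k *: h + x) - (f x + k * D)| <= e * `|k|.
Proof.
move=> [df f'] e0.
have H : k^-1 *: ((f \o shift x) (k *: h) - f x) @[k --> 0^'] --> 'D_h f x.
  exact: df.
rewrite f' in H.
have /cvgrPdist_le/(_ e e0) := H.
rewrite near_withinE; apply: filterS => k kP.
have [->|k0] := eqVneq k 0.
  by rewrite scale0r add0r mul0r addr0 subrr !normr0 mulr0.
have := kP k0.
have -> : D - k^-1 *: ((f \o shift x) (k *: h) - f x) =
    - (k^-1 * (f (k *: h + x) - (f x + k * D))).
  rewrite -[k^-1 *: _]/(k^-1 * (f (k *: h + x) - f x)); field; exact: k0.
by rewrite normrN normrM normfV ler_pdivrMl ?normr_gt0// [leRHS]mulrC.
Qed.

Lemma is_derive_of_near (R : realType) (V : normedModType R) (f : V -> R) (x h : V)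
    (D : R) :
  (forall e, 0 < e ->
    \forall k \near (0 : R), `|f (k *: h + x) - (f x + k * D)| <= e * `|k|) ->
  is_derive x h f D.
Proof.
move=> H.
have Hc : k^-1 *: ((f \o shift x) (k *: h) - f x) @[k --> 0^'] --> (D : R).
  apply/cvgrPdist_le => e e0; rewrite near_withinE; have := H e e0.
  apply: filterS => k kP k0.
  have -> : D - k^-1 *: ((f \o shift x) (k *: h) - f x) =
      - (k^-1 * (f (k *: h + x) - (f x + k * D))).
    rewrite -[k^-1 *: _]/(k^-1 * (f (k *: h + x) - f x)); field; exact: k0.
  by rewrite normrN normrM normfV ler_pdivrMl ?normr_gt0// [leRHS]mulrC.
apply: DeriveDef; first by apply/cvg_ex; exists D.
exact: cvg_lim.
Qed.

(** * Directional derivatives of the Perron root *)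

Section ExponentialFamilyDerivative.
Context (R : realType) (d n : nat) (s : seq 'rV[int]_d).
Context (a : 'I_n.+1 -> 'I_n.+1 -> 'rV[int]_d -> R) (M : 'rV[R]_d -> 'M[R]_n.+1).
Context (ME : forall t i j,
  M t i j = \sum_(x <- s) expR (dotv t (real_of_Zd R x)) * a i j x).
Context (Mirr : forall t, irreducible_mx (M t)).

Local Notation rho t := (spectral_radius (M t)).
Local Notation dM := (expfam_dmx s a).

(* The test vector is r + k v with v chosen to make M(x + k h) (r + k v) equal
   to (rho x + k D) (r + k v) to first order; Collatz-Wielandt then pins
   rho (x + k h) between rho x + k D - e|k| and rho x + k D + e|k|. *)
Lemma expfam_rho_is_derive x h (l : 'rV[R]_n.+1) (r : 'cV[R]_n.+1) :
  pos_mx l -> pos_mx r -> l *m M x = rho x *: l -> M x *m r = rho x *: r ->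
  is_derive x h (fun t => rho t)
    ((l *m dM x h *m r) 0 0 / (l *m r) 0 0).
Proof.
move=> l0 r0 lM Mr.
set D := _ / _.
have lr0 : (l *m r) 0 0 != 0.
  rewrite gt_eqF//; apply: (mulmx_nneg_pos_gt0 (l := 0)) => //; exact: pos_nneg.
(* The value of [D] is exactly the one for which [l] annihilates the right-hand side. *)
have [v vE] : exists v : 'cV[R]_n.+1,
    rho x *: v - M x *m v = dM x h *m r - D *: r.
  apply: (perron_solvable (Mirr x) l0 lM); rewrite mulmxBr mulmxA -scalemxAr.
  apply/matrixP => i j; rewrite !ord1 mxE [X in _ + X]mxE [X in _ - X]mxE /D.
  by rewrite divfK// [RHS]mxE subrr.
pose w k : 'cV[R]_n.+1 := r + k *: v.
(* The defect of [w k] as an eigenvector for [rho x + k D]. It vanishes at [0] together with its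
   derivative, by the choice of [v], so it is [o(k)]. *)
pose q i k := (M (k *: h + x) *m w k) i 0 - (rho x + k * D) * w k i 0.
have q0 i : q i 0 = 0.
  by rewrite /q /w !scale0r mul0r !addr0 add0r Mr mxE subrr.
have dw i : is_derive (0 : R) 1 (fun k => w k i 0) (v i 0).
  rewrite (_ : (fun k => _) = cst (r i 0) + v i 0 \*: id); last first.
    by apply/funext => k; rewrite !mxE /= mulrC.
  by apply: is_derive_eq; rewrite add0r [LHS]mulr1.
have dlam : is_derive (0 : R) 1 (fun k => rho x + k * D) D.
  rewrite (_ : (fun k => _) = cst (rho x) + D \*: id); last first.
    by apply/funext => k; rewrite /= mulrC.
  by apply: is_derive_eq; rewrite add0r [LHS]mulr1.
have dq i : is_derive (0 : R) 1 (q i) 0.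
  have dprod j := is_deriveM (expfam_is_derive ME x h i j) (dw j).
  have dsum := @is_derive_bigsum _ _ (index_enum 'I_n.+1) _ _ _ dprod.
  have := is_deriveB dsum (is_deriveM dlam (dw i)).
  rewrite (_ : (_ - _)%R = q i); last first.
    by apply/funext => k; rewrite /q mxE.
  move=> H; apply: (is_derive_eq H).
  have w00 j : w 0 j 0 = r j 0 by rewrite /w scale0r addr0.
  transitivity (\sum_j (M x i j * v j 0 + r j 0 * dM x h i j) -
      (rho x * v i 0 + r i 0 * D)).
    rewrite w00 mul0r addr0; congr (_ - _); apply: eq_bigr => j _.
    by rewrite w00 scale0r add0r.
  have /matrixP/(_ i 0) := vE.
  rewrite mxE [X in X + _]mxE [X in _ + X]mxE [X in _ - X]mxE [RHS]mxE.
  rewrite [X in _ = X + _]mxE [X in _ = _ + X]mxE [X in _ = _ - X]mxE => {}vE.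
  rewrite big_split/=; under [X in _ + X - _]eq_bigr do rewrite mulrC.
  rewrite (mulrC (r i 0)); move: vE; lra.
apply: is_derive_of_near => e e0.
(* The lower bound [r / 2] keeps [w k] positive and turns the absolute bound on the defect into one
   relative to [w k]. *)
have near_w i : \forall k \near (0 : R), r i 0 / 2 < w k i 0.
  have wc : (fun k => w k i 0) k @[k --> (0 : R)] --> w 0 i 0.
    by apply/differentiable_continuous/derivable1_diffP; case: (dw i).
  apply: (cvgr_gt _ wc); rewrite /w scale0r addr0 ltr_pdivrMr// ltr_pMr//.
  by rewrite ltr1n.
have near_q i : \forall k \near (0 : R), `|q i k| <= e * (r i 0 / 2) * `|k|.
  have ei0 : 0 < e * (r i 0 / 2) by rewrite mulr_gt0// divr_gt0.
  apply: filterS (is_derive_near (dq i) ei0) => k.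
  by rewrite q0 mulr0 !addr0 subr0 (_ : k *: (1 : R) = k)//; exact: mulr1.
have near_all : \forall k \near (0 : R), forall i,
    r i 0 / 2 < w k i 0 /\ `|q i k| <= e * (r i 0 / 2) * `|k|.
  apply: (@filter_forall _ 'I_n.+1 (fun i k => r i 0 / 2 < w k i 0 /\
    `|q i k| <= e * (r i 0 / 2) * `|k|) (nbhs (0 : R)) (nbhs_filter _)) => i.
  exact: (filterS2 _ (fun k A B => conj A B) (near_w i) (near_q i)).
apply: filterS near_all => k kP.
have w0 : pos_mx (w k).
  move=> i j; rewrite ord1; have [+ _] := kP i; apply: lt_trans.
  by rewrite divr_gt0.
have qw i : `|q i k| <= e * `|k| * w k i 0.
  have [wi qi] := kP i; rewrite (le_trans qi)// mulrAC ler_wpM2l ?(ltW wi)//.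
  by rewrite mulr_ge0// ltW.
rewrite ler_norml; apply/andP; split.
  rewrite lerBrDl; apply: (collatz_wielandt_ge (Mirr _) w0) => i.
  rewrite mulrDl -lerBrDl; have := qw i; rewrite ler_norml => /andP[+ _].
  by rewrite mulNr.
rewrite lerBlDl; apply: (collatz_wielandt_le (Mirr _) w0) => i.
rewrite mulrDl -lerBlDl; have := qw i; rewrite ler_norml => /andP[_ +].
by [].
Qed.

End ExponentialFamilyDerivative.

(** * Gradient of the Perron root and compactness of its sublevel set *)

Section ExponentialFamilyLevelSet.
Context (R : realType) (d n : nat) (s : seq 'rV[int]_d).
Context (a : 'I_n.+1 -> 'I_n.+1 -> 'rV[int]_d -> R) (M : 'rV[R]_d -> 'M[R]_n.+1).
Context (ME : forall t i j,
  M t i j = \sum_(x <- s) expR (dotv t (real_of_Zd R x)) * a i j x).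
Context (Mirr : forall t, irreducible_mx (M t)).

Local Notation rho t := (spectral_radius (M t)).

Lemma expfam_dmx_linear x h :
  expfam_dmx s a x h = \sum_k h 0 k *: expfam_dmx s a x (delta_mx 0 k).
Proof.
apply/matrixP => i j; rewrite summxE mxE.
under [RHS]eq_bigr do rewrite mxE mxE mulr_sumr.
rewrite exchange_big/=; apply: eq_bigr => z _.
rewrite {1}/dotv !mulr_suml; apply: eq_bigr => k _.
by rewrite [dotv (delta_mx _ _) _]dotvC dotv_delta !mulrA.
Qed.

(** The derivative of [M] is linear in the direction, so one vector of partial derivatives
    represents all directional derivatives of the Perron root. *)
Lemma expfam_rho_gateaux x : exists g : 'rV[R]_d, forall h,
  is_derive x h (fun t => rho t) (dotv g h).
Proof.
have [l [r [l0 r0 lM Mr]]] := perron_frobenius (Mirr x).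
exists (\row_k ((l *m expfam_dmx s a x (delta_mx 0 k) *m r) 0 0 / (l *m r) 0 0)).
move=> h; apply: (is_derive_eq (expfam_rho_is_derive ME Mirr h l0 r0 lM Mr)).
rewrite expfam_dmx_linear mulmx_sumr mulmx_suml summxE mulr_suml.
apply: eq_bigr => k _.
by rewrite -scalemxAr -scalemxAl !mxE [RHS]mulrC mulrA.
Qed.

Context (Mdiag : forall z, exists k, exists2 q, 0 < q & forall t,
  q * expR (dotv t (real_of_Zd R z)) <= (M t ^+ k) 0 0).

(** In row [i] of [A^k r = rho^k r], keep only the diagonal term and divide by [r i 0]. *)
Lemma irreducible_expr_diag_le (A : 'M[R]_n.+1) k i : irreducible_mx A ->
  (A ^+ k) i i <= spectral_radius A ^+ k.
Proof.
move=> irrA; have [A0 _] := irrA.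
have [_ [r [_ r0 _ Ar]]] := perron_frobenius irrA.
have /matrixP/(_ i 0) : A ^+ k *m r = spectral_radius A ^+ k *: r.
  elim: k => [|k IH]; first by rewrite !expr0 mul1mx scale1r.
  by rewrite exprSr -mulmxA Ar -scalemxAr IH scalerA exprS.
rewrite mxE [RHS]mxE (bigD1 i)//= => E; rewrite -(ler_pM2r (r0 i 0)) -E lerDl.
by apply: sumr_ge0 => j _; rewrite mulr_ge0 ?nneg_expr// ltW.
Qed.

Lemma expfam_sublevel_compact : compact [set t | rho t <= 1].
Proof.
(* From [q exp(t.z) <= (M^k) 0 0 <= rho^k <= 1] follows [t.z <= - ln q]; the vectors [z = +- e_k]
   then bound every coordinate. *)
have Bz (z : 'rV[int]_d) : exists B, forall t, rho t <= 1 ->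
    dotv t (real_of_Zd R z) <= B.
  have [k [q q0 qM]] := Mdiag z; exists (- ln q) => t t1.
  rewrite -ler_expR expRN lnK ?posrE// -(ler_pM2l q0) mulfV ?gt_eqF//.
  rewrite (le_trans (qM t))// (le_trans (irreducible_expr_diag_le _ _ (Mirr t)))//.
  by rewrite exprn_ile1// (expfam_rho_ge0 Mirr).
have Bk k : exists B, forall t, rho t <= 1 -> `|t 0 k| <= B.
  have [B1 B1P] := Bz (delta_mx 0 k); have [B2 B2P] := Bz (- delta_mx 0 k).
  exists (Num.max B1 B2) => t t1; have := B1P t t1; have := B2P t t1.
  rewrite (_ : real_of_Zd R (- delta_mx 0 k) = - delta_mx 0 k); last first.
    by apply/matrixP => i j; rewrite !mxE rmorphN rmorph_nat.
  rewrite (_ : real_of_Zd R (delta_mx 0 k) = delta_mx 0 k); last first.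
    by apply/matrixP => i j; rewrite !mxE rmorph_nat.
  rewrite dotvNr dotv_delta => tB2 tB1; rewrite ler_norml lerNl.
  by rewrite !le_max tB1 tB2 orbT.
have [B BP] := choice Bk.
apply: (@subclosed_compact _ _ [set v : 'rV[R]_d |
    forall k, `[- B k, B k]%classic (v 0 k)]).
- rewrite -openC (_ : ~` _ = [set t | 1 < rho t]).
    exact: (expfam_rho_gt_open ME Mirr).
  by apply/seteqP; split=> t /=; rewrite ltNge => /negP.
- have := @rV_compact R d (fun k => `[- B k, B k]%classic).
  by apply=> k; exact: segment_compact.
- by move=> t /= t1 k; rewrite /= in_itv/= -ler_norml BP.
Qed.

End ExponentialFamilyLevelSet.

(** * Sublevel sets of a convex function and their dual curve *)

(** A single small step inside []0, 1[] suffices later, where the estimate is confronted with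
    convexity on a segment. *)
Lemma is_derive_ex_near (R : realType) (V : normedModType R) (f : V -> R)
    (x h : V) (D e : R) : is_derive x h f D -> 0 < e ->
  exists s, [/\ 0 < s, s < 1 & `|f (s *: h + x) - (f x + s * D)| <= e * s].
Proof.
move=> fD e0; have /nbhs_ballP[r /= r0 rP] := is_derive_near fD e0.
have [s [s0 s1 sr]] : exists s : R, [/\ 0 < s, s < 1 & s < r].
  exists (Num.min (r / 2) (2^-1)); split.
  - by rewrite lt_min invr_gt0 ltr0n andbT divr_gt0.
  - by rewrite gt_min [2^-1 < 1]invf_lt1// ltr1n orbT.
  - by rewrite gt_min ltr_pdivrMr// ltr_pMr// ltr1n.
exists s; split => //; have := rP s.
by rewrite /ball /= sub0r normrN gtr0_norm// => /(_ sr).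
Qed.

Section ConvexSublevel.
Context (R : realType) (d : nat) (f : 'rV[R]_d -> R).
Context (f_convex : forall x y k, 0 <= k -> k <= 1 ->
  f ((1 - k) *: x + k *: y) <= (1 - k) * f x + k * f y).
Context (f0 : f 0 < 1).
Context (f_lt_open : open [set t | f t < 1]) (f_gt_open : open [set t | 1 < f t]).

Lemma sublevel_closed : closed [set t | f t <= 1].
Proof.
rewrite -openC (_ : ~` _ = [set t | 1 < f t])//.
by apply/seteqP; split=> t /=; rewrite ltNge => /negP.
Qed.

(** Convexity on the segment from [0], where [f < 1] strictly, makes shrinking towards [0] strict;
    the interior and the closure below rest on this. *)
Lemma sublevel_scale t k : f t <= 1 -> 0 <= k -> k < 1 -> f (k *: t) < 1.
Proof.
move=> t1 k0 k1; have := f_convex 0 t k0 (ltW k1); rewrite scaler0 add0r.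
move=> /le_lt_trans; apply; rewrite -[ltRHS](subrK k) ltr_leD//.
  by rewrite gtr_pMr ?subr_gt0.
by rewrite ler_piMr.
Qed.

Lemma scale_near (A : set 'rV[R]_d) (t : 'rV[R]_d) :
  nbhs t A -> \forall k \near (1 : R), A (k *: t).
Proof.
move=> At; have : (fun k : R => k *: t) k @[k --> (1 : R)] --> 1 *: t.
  exact: scalel_continuous.
by rewrite scale1r => /(_ A At).
Qed.

Lemma sublevel_interior : [set t | f t <= 1]° = [set t | f t < 1].
Proof.
apply/seteqP; split => t.
  move=> /scale_near /nbhs_ballP[r /= r0 rP].
  (* An interior point can be pushed outwards to [k t] within the sublevel set; shrinking it back to
     [t] makes the inequality strict. *)
  pose k := 1 + r / 2.
  have k1 : 1 < k by rewrite ltrDl divr_gt0.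
  have kt : f (k *: t) <= 1.
    apply: rP; rewrite /ball /= /k opprD addrA subrr sub0r normrN gtr0_norm ?divr_gt0//.
    by rewrite ltr_pdivrMr// ltr_pMr// ltr1n.
  have k0 : 0 < k by rewrite (lt_trans _ k1).
  rewrite -[t](scalerK (lt0r_neq0 k0)) /=; apply: sublevel_scale => //.
    by rewrite invr_ge0 ltW.
  by rewrite invf_lt1.
move=> t1; apply: filterS (open_nbhs_nbhs (conj f_lt_open t1)) => u; exact: ltW.
Qed.

Lemma sublevel_closure : closure [set t | f t < 1] = [set t | f t <= 1].
Proof.
apply/seteqP; split.
  rewrite [X in _ `<=` X](closure_id _).1; last exact: sublevel_closed.
  by apply: closure_subset => u; exact: ltW.
move=> t /= t1 A /scale_near /nbhs_ballP[r /= r0 rP].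
(* The bound [r / 2] keeps [k t] in the given neighbourhood, and [1/2] keeps [k] nonnegative. *)
pose k := 1 - Num.min (r / 2) (2^-1).
have s0 : 0 < Num.min (r / 2) (2^-1) by rewrite lt_min invr_gt0 ltr0n andbT divr_gt0.
have s1 : Num.min (r / 2) (2^-1) <= 1.
  by rewrite ge_min [2^-1 <= 1]invf_le1// ler1n orbT.
exists (k *: t); split.
  by apply: sublevel_scale => //; rewrite /k ?subr_ge0// gtrBl.
apply: rP; rewrite /ball /= /k opprB addrC subrK gtr0_norm//.
by rewrite gt_min ltr_pdivrMr// ltr_pMr// ltr1n.
Qed.

Lemma sublevel_frontier : frontier [set t | f t <= 1] = [set t | f t = 1].
Proof.
rewrite /frontier sublevel_interior -(closure_id _).1; last exact: sublevel_closed.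
apply/seteqP; split=> t /= => [[t1 /negP]|->]; last by rewrite ltxx.
by rewrite -leNgt => t1'; apply/eqP; rewrite eq_le t1 t1'.
Qed.

Lemma strict_sublevel_frontier : frontier [set t | f t < 1] = [set t | f t = 1].
Proof.
rewrite -sublevel_frontier /frontier sublevel_closure sublevel_interior.
rewrite -(closure_id _).1; last exact: sublevel_closed.
by rewrite (interior_id _).1.
Qed.

(** Segments from [0] join the points of [{f < 1}] outside [A]. Conversely, within the component
    [{f < 1}] is open, and also closed because [{f = 1}] lies in [A]; so it exhausts the
    component. *)
Lemma sublevel_component (A : set 'rV[R]_d) : [set t | f t < 1] `<=` ~` A ->
  [set t | f t = 1] `<=` A -> connected_component (~` A) 0 = [set t | f t < 1].
Proof.
move=> ltA eqA; apply/seteqP; split; last first.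
  move=> t /= t1.
  apply: (@connected_component_max _ _ ((fun k : R => k *: t) @` `[0, 1]%classic)).
  - by exists 0; rewrite ?scale0r//= in_itv/= lexx ler01.
  - move=> _ [k /= + <-]; rewrite in_itv/= => /andP[k0 k1]; apply: ltA => /=.
    have := f_convex 0 t k0 k1; rewrite scaler0 add0r.
    move=> /le_lt_trans; apply.
    have [->|k1'] := eqVneq k 1; first by rewrite subrr mul0r add0r mul1r.
    rewrite -[ltRHS](subrK k) ltr_leD//.
      by rewrite gtr_pMr ?subr_gt0// lt_neqAle k1'.
    by rewrite ler_piMr// ltW.
  - apply: connected_continuous_connected.
      exact/connected_intervalP/interval_is_interval.
    by apply: continuous_subspaceT => k; exact: scalel_continuous.
  - by exists 1; rewrite ?scale1r//= in_itv/= lexx ler01.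
set C := connected_component _ _.
have CA : C `<=` ~` A by exact: connected_component_sub.
have C0 : C 0 by apply: connected_component_refl; exact: ltA.
suff <- : C `&` [set t | f t < 1] = C by move=> t [].
apply: component_connected.
- by exists 0.
- by exists [set t | f t < 1].
- exists [set t | f t <= 1]; first exact: sublevel_closed.
  apply/seteqP; split => t /= [Ct t1]; split => //; first exact: ltW.
  rewrite lt_neqAle t1 andbT; apply/eqP => ft; exact: (CA t Ct (eqA t ft)).
Qed.

End ConvexSublevel.

Section EuclideanNorm.
Context (R : realType) (d : nat).
Implicit Types u : 'rV[R]_d.

Lemma eucl_normZ b u : eucl_norm (b *: u) = `|b| * eucl_norm u.
Proof.
by rewrite /eucl_norm dotvZl dotvZr mulrA -expr2 sqrtrM ?sqr_ge0// sqrtr_sqr.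
Qed.

Lemma eucl_norm_gt0 u : u != 0 -> 0 < eucl_norm u.
Proof.
move=> u0; rewrite sqrtr_gt0 lt_neqAle dotv_ge0 andbT eq_sym.
by apply: contra u0 => /eqP/dotv_eq0 ->.
Qed.

Lemma unit_sphere_neq0 u : unit_sphere u -> u != 0.
Proof.
move=> u1; apply/eqP => u0; move/eqP: u1.
by rewrite u0 /eucl_norm dot0v sqrtr0 eq_sym oner_eq0.
Qed.

Lemma unit_sphere_normalize u : u != 0 -> unit_sphere ((eucl_norm u)^-1 *: u).
Proof.
move=> u0; rewrite /unit_sphere/= eucl_normZ gtr0_norm ?invr_gt0 ?eucl_norm_gt0//.
by rewrite mulVf// gt_eqF// eucl_norm_gt0.
Qed.

End EuclideanNorm.

(** * Normal cones, Gauss map and dual curve of a level set *)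

Section DualOfLevelSet.
Context (R : realType) (d : nat) (f : 'rV[R]_d -> R).
Context (f_convex : forall x y k, 0 <= k -> k <= 1 ->
  f ((1 - k) *: x + k *: y) <= (1 - k) * f x + k * f y).
Context (f0 : f 0 < 1).
Context (f_lt_open : open [set t | f t < 1]) (f_gt_open : open [set t | 1 < f t]).
Context (f_compact : compact [set t | f t <= 1]).
Context (f_gateaux : forall x, exists g : 'rV[R]_d, forall h,
  is_derive x h f (dotv g h)).

Local Notation T := [set t | f t <= 1].
Local Notation grad := (gradient f).

Lemma is_derive_gradient x h : is_derive x h f (dotv (grad x) h).
Proof.
have [g gP] := f_gateaux x; rewrite (_ : grad x = g); first exact: gP.
apply/matrixP => i k; rewrite ord1 mxE.
by have [_ ->] := gP (delta_mx 0 k); rewrite dotv_delta.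
Qed.

(** If it failed, the first-order expansion with half the gap as tolerance would put [f] above its
    chord at a small step. *)
Lemma tangent_le x y : dotv (grad x) (y - x) <= f y - f x.
Proof.
set D := dotv _ _; rewrite leNgt; apply/negP => ltD.
pose e := (D - (f y - f x)) / 2.
have e0 : 0 < e by rewrite divr_gt0// subr_gt0.
have [s [s0 s1]] := is_derive_ex_near (is_derive_gradient x (y - x)) e0.
rewrite -/D (_ : s *: (y - x) + x = (1 - s) *: x + s *: y); last first.
  by rewrite scalerBr scalerBl scale1r addrC addrA addrAC.
have := f_convex x y (ltW s0) (ltW s1).
rewrite ler_norml => fs /andP[fD _].
have : s * D - e * s <= s * (f y - f x).
  by move: fs fD; rewrite mulrBl mulrBr mul1r; lra.
rewrite (mulrC e) -mulrBr ler_pM2l// /e; lra.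
Qed.

Lemma dotv_gradient_gt0 x : f x = 1 -> 0 < dotv (grad x) x.
Proof.
move=> fx; have := tangent_le x 0; rewrite sub0r dotvNr fx; move: f0; lra.
Qed.

Lemma gradient_neq0 x : f x = 1 -> grad x != 0.
Proof.
move=> /dotv_gradient_gt0; apply: contraTneq => ->.
by rewrite dot0v ltxx.
Qed.

Lemma gradient_normal x : f x = 1 -> normal_cone T x (grad x).
Proof.
by move=> fx y /= y1; rewrite (le_trans (tangent_le x y))// fx subr_le0.
Qed.

Lemma normal_coneZ (K : set 'rV[R]_d) (x z : 'rV[R]_d) (b : R) :
  0 <= b -> normal_cone K x z -> normal_cone K x (b *: z).
Proof. by move=> b0 zN y Ky; rewrite dotvZl mulr_ge0_le0//; exact: zN. Qed.

(* Every direction h with grad.h < 0 enters T, hence z.h <= 0; testing this on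
   h = - grad and on h = w - e grad, where w is the component of z orthogonal
   to grad, leaves z on the ray of grad. *)
Lemma normal_cone_ray x z : f x = 1 -> normal_cone T x z ->
  exists2 b, 0 <= b & z = b *: grad x.
Proof.
move=> fx zN.
have descent h : dotv (grad x) h < 0 -> dotv z h <= 0.
  move=> gh; have e0 : 0 < - dotv (grad x) h by rewrite oppr_gt0.
  have [s [s0 s1]] := is_derive_ex_near (is_derive_gradient x h) e0.
  rewrite ler_norml fx => /andP[_ fs].
  have /zN : T (s *: h + x) by move: fs => /=; lra.
  by rewrite addrK dotvZr pmulr_rle0.
have g0 : 0 < dotv (grad x) (grad x).
  rewrite lt_neqAle dotv_ge0 andbT eq_sym; apply/eqP => /dotv_eq0/eqP.
  by apply/negP/gradient_neq0.
pose b := dotv z (grad x) / dotv (grad x) (grad x).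
pose w := z - b *: grad x.
have wg : dotv (grad x) w = 0.
  by rewrite /w dotvDr dotvNr dotvZr /b divfK ?gt_eqF// dotvC subrr.
have b0 : 0 <= b.
  rewrite divr_ge0 ?(ltW g0)// -oppr_le0 -dotvNr; apply: descent.
  by rewrite dotvNr oppr_lt0.
exists b => //; apply/eqP; rewrite -subr_eq0 -/w; apply/eqP/dotv_eq0/eqP.
rewrite eq_le dotv_ge0 andbT; apply/ler_addgt0Pr => e e0.
(* Makes [k |z.grad|] at most [e]; the added [1] keeps the denominator positive. *)
pose k := e / (`|dotv z (grad x)| + 1).
have k0 : 0 < k by rewrite divr_gt0// ltr_wpDl.
have /descent : dotv (grad x) (w - k *: grad x) < 0.
  by rewrite dotvDr wg add0r dotvNr dotvZr oppr_lt0 mulr_gt0.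
have zw : dotv z w = dotv w w.
  by rewrite {2}/w dotvDl dotvNl dotvZl wg mulr0 subr0.
rewrite dotvDr dotvNr dotvZr zw subr_le0 add0r => /le_trans; apply.
rewrite (le_trans (ler_norm _))// normrM gtr0_norm// /k mulrAC ler_pdivrMr ?ltr_wpDl//.
by rewrite ler_wpM2l ?(ltW e0)// lerDl.
Qed.

(** A maximizer of [u] on the compact sublevel set; were [f < 1] there, a small move along [u] would
    stay in the set and increase the functional. *)
Lemma support_point u : u != 0 -> exists2 x, f x = 1 & normal_cone T x u.
Proof.
move=> u0.
have [x /set_mem/= x1 xmax] : exists2 x, x \in T & forall y, y \in T ->
    dotv y u <= dotv x u.
  apply: (compact_EVT_max _ f_compact); first by exists 0; exact: ltW.
  by apply: continuous_subspaceT; exact: dotv_cont.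
have xN : normal_cone T x u.
  move=> y /mem_set/xmax; by rewrite dotvDr dotvNr subr_le0 !(dotvC u).
exists x => //; apply/eqP; rewrite eq_le x1 leNgt; apply/negP => fx.
(* [B] bounds [f (u + x)], and [s] solves [f x + s (B - f x) = 1], so convexity keeps [s u + x] in
   the set; [B >= 1] ensures [s <= 1]. *)
pose B := Num.max (f (u + x)) 1.
have B0 : 0 < B - f x by rewrite subr_gt0 lt_max fx orbT.
pose s := (1 - f x) / (B - f x).
have s0 : 0 < s by rewrite divr_gt0// subr_gt0.
have s1 : s <= 1 by rewrite ler_pdivrMr// mul1r lerD2r le_max lexx orbT.
have /xN : T (s *: u + x).
  rewrite /= (_ : s *: u + x = (1 - s) *: x + s *: (u + x)); last first.
    by rewrite scalerBl scale1r scalerDr [s *: u + s *: x]addrC addrA subrK addrC.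
  apply: (le_trans (f_convex x (u + x) (ltW s0) s1)).
  have : s * f (u + x) <= s * B by rewrite ler_pM2l// le_max lexx.
  have : s * (B - f x) = 1 - f x by rewrite /s divfK// gt_eqF.
  rewrite mulrBr mulrBl mul1r; lra.
rewrite addrK dotvZr pmulr_rle0//; apply/negP; rewrite -ltNge.
by rewrite lt_neqAle dotv_ge0 andbT eq_sym; apply: contra u0 => /eqP/dotv_eq0 ->.
Qed.

Local Notation G := (fun t => (eucl_norm (grad t))^-1 *: grad t).
Local Notation S := (@unit_sphere R d).

Lemma normal_cone_unit x u : f x = 1 -> S u -> normal_cone T x u -> G x = u.
Proof.
move=> fx Su /(normal_cone_ray fx)[b b0 uE].
have g0 := eucl_norm_gt0 (gradient_neq0 fx).
have : eucl_norm u = 1 by [].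
rewrite uE eucl_normZ ger0_norm// => bg; congr (_ *: _).
by apply: (mulIf (lt0r_neq0 g0)); rewrite mulVf ?gt_eqF.
Qed.

(** Surjectivity makes the partial inverse a genuine right inverse of the Gauss map on the
    sphere. *)
Lemma gauss_surj : set_surj (frontier T) S G.
Proof.
move=> u Su; have [x fx xN] := support_point (unit_sphere_neq0 Su).
exists x; last exact: normal_cone_unit.
by rewrite sublevel_frontier.
Qed.

(* Two points of the frontier with the same outer normal u both maximize u on T,
   so the preimage of u chosen by the partial inverse does not matter. *)
Lemma gauss_dual_curve :
  [set (dotv ('pinv_(fun=> 0) (frontier T) G u) u)^-1 *: u | u in S] =
  \bigcup_(x in frontier T) dual_points T x.
Proof.
set Ginv := 'pinv_(fun=> 0) (frontier T) G.
have frE x : frontier T x = (f x = 1) by rewrite sublevel_frontier.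
have GinvT u : S u -> f (Ginv u) = 1.
  move=> Su; rewrite -frE.
  by apply: (surjpinv_image_sub gauss_surj); exists u.
have GinvK u : S u -> G (Ginv u) = u.
  by move=> Su; apply: (surjpK _ gauss_surj); apply: mem_set.
have Gnormal x : f x = 1 -> normal_cone T x (G x).
  move=> fx; apply: normal_coneZ; last exact: gradient_normal.
  by rewrite invr_ge0 sqrtr_ge0.
have Gdot x : f x = 1 -> 0 < dotv (G x) x.
  move=> fx; rewrite dotvZl mulr_gt0 ?dotv_gradient_gt0// invr_gt0.
  exact/eucl_norm_gt0/gradient_neq0.
apply/seteqP; split => [_ [u Su <-]|z [x]].
  have fx := GinvT u Su; have Gx := GinvK u Su.
  have ux := Gdot _ fx; have uN := Gnormal _ fx; rewrite Gx in ux uN.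
  exists (Ginv u); first by rewrite frE.
  split; last by rewrite dotvZl (dotvC (Ginv u)) mulVf// gt_eqF.
  by apply: normal_coneZ => //; rewrite invr_ge0 dotvC ltW.
rewrite frE => fx [zN zx].
have [b b0 zE] := normal_cone_ray fx zN.
have Su : S (G x) by exact/unit_sphere_normalize/gradient_neq0.
exists (G x) => //.
have fy := GinvT _ Su; have Gy := GinvK _ Su.
have xy : dotv (Ginv (G x)) (G x) = dotv (G x) x.
  apply/eqP; rewrite eq_le dotvC; apply/andP; split.
    have := Gnormal _ fx (Ginv (G x)); rewrite dotvDr dotvNr subr_le0; apply.
    by rewrite /= fy.
  have := Gnormal _ fy x; rewrite Gy dotvDr dotvNr subr_le0; apply.
  by rewrite /= fx.
have g0 := eucl_norm_gt0 (gradient_neq0 fx).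
rewrite xy dotvZl invfM invrK scalerA mulrAC divff ?gt_eqF// mul1r zE.
congr (_ *: _); move: zx; rewrite zE dotvZl => bx.
have gx := dotv_gradient_gt0 fx.
by apply: (mulIf (lt0r_neq0 gx)); rewrite mulVf ?gt_eqF.
Qed.

Lemma sublevel_is_dual_curve : is_dual_curve (frontier [set t | f t < 1])
  [set (dotv ('pinv_(fun=> 0) (frontier T) G u) u)^-1 *: u | u in S].
Proof.
(* The convex body is the closed sublevel set, which has the same frontier as the open one. *)
exists T; split.
- exact: f_compact.
- move=> x y k /set_mem/= x1 /set_mem/= y1; apply/mem_set => /=.
  have k0 : 0 <= k%:num by []. have k1 : k%:num <= 1 by [].
  have := f_convex y x k0 k1; rewrite addrC => /le_trans; apply.
  by rewrite -[leRHS](subrK k%:num) lerD// ler_piMr// subr_ge0.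
- by rewrite sublevel_interior.
- by rewrite sublevel_frontier// strict_sublevel_frontier.
- by rewrite gauss_dual_curve sublevel_frontier// strict_sublevel_frontier.
Qed.

End DualOfLevelSet.

(** * The amoeba *)

Lemma normc_monomial (R : realType) d (z : 'rV[complex R]_d) (x : 'rV[int]_d) :
  (forall k, z 0 k != 0) ->
  Normc.normc (monomial z x) =
  expR (dotv (\row_k ln (Normc.normc (z 0 k))) (real_of_Zd R x)).
Proof.
move=> z0; rewrite /monomial /dotv expR_sum.
rewrite (big_morph _ (@Normc.normcM R) (@Normc.normc1 R)).
apply: eq_bigr => k _; rewrite !mxE.
have nz : 0 < Normc.normc (z 0 k).
  rewrite lt_neqAle normc_ge0 andbT eq_sym; apply: contra (z0 k) => /eqP.
  by move/Normc.eq0_normc => ->.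
have normcX (w : complex R) j : Normc.normc (w ^+ j) = Normc.normc w ^+ j.
  elim: j => [|j IH]; first by rewrite !expr0 Normc.normc1.
  by rewrite !exprS Normc.normcM IH.
case: (x 0 k) => j.
  by rewrite -exprnP normcX expRM_natr lnK ?posrE.
rewrite NegzE -exprnN Normc.normcV normcX mulrNz mulrN expRN.
by rewrite expRM_natr lnK ?posrE.
Qed.

Section Amoeba.
Context (R : realType) (d n : nat).
Context (c : 'rV[int]_d -> 'I_n.+1 -> 'I_n.+1 -> R) (m : 'I_n.+1 -> R).
Context (hc : forall x i j, 0 <= c x i j).
Context (hsigma : forall i, (0 < sigma c i < +oo)%E).
Context (hm : forall i, 1 <= m i).
Context (s : seq 'rV[int]_d) (us : uniq s).
Context (hs : forall i j x, mu c m i j x != 0 -> x \in s).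
Context (hirr : krw_irreducible c m).

Let Mirr := Lmu_irreducible hc hsigma hm us hs hirr.

(** Test Collatz-Wielandt on the constant vector: all row sums are at most [1], and one is strictly
    smaller. *)
Lemma rho0_lt1 : (exists i, 1 < m i) -> rho c m 0 < 1.
Proof.
move=> [i mi]; rewrite /rho.
have row j : (Lmu c m 0 *m const_mx 1 : 'cV[R]_n.+1) j 0 <= (m j)^-1.
  rewrite mxE; under eq_bigr do rewrite [const_mx _ _ _]mxE mulr1.
  exact: (Lmu0_row_le hc hsigma hm us hs).
have m0 j : 0 < m j by exact: lt_le_trans (hm j).
apply: (collatz_wielandt_lt (Mirr 0) (w := const_mx 1)).
- by move=> j k; rewrite mxE.
- by move=> j; rewrite [const_mx _ _ _]mxE mulr1 (le_trans (row j))// invf_le1.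
- by exists i; rewrite [const_mx _ _ _]mxE mulr1 (le_lt_trans (row i))// invf_lt1.
Qed.

Lemma FmuE z i j : Fmu c m z i j =
  \sum_(x <- s) monomial z x * real_complex R (mu c m i j x).
Proof.
rewrite mxE -(fsbig_widen [set` s])//= => [|x [_ /= xs]]; first by rewrite -fsbig_seq.
have [->|/hs//] := eqVneq (mu c m i j x) 0; by rewrite mulr0.
Qed.

Lemma normc_Fmu_le (z : 'rV[complex R]_d) i j : (forall k, z 0 k != 0) ->
  Normc.normc (Fmu c m z i j) <= Lmu c m (\row_k ln (Normc.normc (z 0 k))) i j.
Proof.
move=> z0; rewrite FmuE (LmuE hc hsigma hm us hs).
rewrite (le_trans (normc_sum _ _ _))//; apply: ler_sum => x _.
rewrite Normc.normcM normc_monomial// normc_real ger0_norm//.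
exact: (mu_ge0 hc hsigma hm).
Qed.

(** A zero of the determinant gives a left eigenvector of [Fmu z] for the eigenvalue [1], whose
    modulus is at most the Perron root of the dominating matrix. *)
Lemma amoeba_rho_ge1 t : amoeba c m t -> 1 <= rho c m t.
Proof.
move=> [z [z0 /eqP/det0P[v v0 vF]] <-].
have [_ [r [_ r0 _ Mr]]] := perron_frobenius (Mirr (\row_k ln (Normc.normc (z 0 k)))).
rewrite -(Normc.normc1 R).
apply: (normc_eigenvalue_le r0 Mr (fun i j => normc_Fmu_le i j z0) v0).
by move: vF; rewrite scale1r mulmxBr mulmx1 => /eqP; rewrite subr_eq0 => /eqP.
Qed.

(** At the positive real point [z = e^t] the matrix [Fmu z] is [Lmu t] itself, and its left Perron
    vector lies in the kernel. *)
Lemma rho_eq1_amoeba t : rho c m t = 1 -> amoeba c m t.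
Proof.
move=> rt; pose z : 'rV[complex R]_d := \row_k real_complex R (expR (t 0 k)).
have nz k : Normc.normc (z 0 k) = expR (t 0 k).
  by rewrite mxE normc_real gtr0_norm ?expR_gt0.
have z0 k : z 0 k != 0.
  rewrite mxE fmorph_eq0; exact/lt0r_neq0/expR_gt0.
have mz x : monomial z x = real_complex R (expR (dotv t (real_of_Zd R x))).
  rewrite /monomial /dotv expR_sum rmorph_prod; apply: eq_bigr => k _.
  rewrite !mxE; case: (x 0 k) => j.
    by rewrite -exprnP -rmorphXn expRM_natr.
  by rewrite NegzE -exprnN -rmorphXn -fmorphV mulrNz mulrN expRN expRM_natr.
exists z; last by apply/matrixP => i k; rewrite ord1 mxE nz expRK.
split=> //; rewrite /charP.
have -> : Fmu c m z = map_mx (real_complex R) (Lmu c m t).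
  apply/matrixP => i j; rewrite FmuE [RHS]mxE (LmuE hc hsigma hm us hs) rmorph_sum.
  by apply: eq_bigr => x _; rewrite mz -rmorphM.
apply/eqP/det0P.
have [l [_ [l0 _ lM _]]] := perron_frobenius (Mirr t).
exists (map_mx (real_complex R) l).
  apply/eqP => /matrixP/(_ 0 0)/eqP; rewrite !mxE fmorph_eq0.
  by rewrite gt_eqF; last exact: l0.
rewrite mulmxBr mulmx1 -map_mxM lM -/(rho c m t) rt scale1r subrr//.
Qed.

End Amoeba.

(** * The component of the origin and its dual curve *)

Theorem mainTheorem9 (R : realType) (d p : nat)
    (c : 'rV[int]_d -> 'I_p -> 'I_p -> R) (m : 'I_p -> R)
    (hd : (1 <= d)%N) (hp : (1 <= p)%N)
    (hc : forall x i j, 0 <= c x i j)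
    (hsigma : forall i, (0 < sigma c i < +oo)%E)
    (hm : forall i, 1 <= m i)
    (hA : assumptionA c m)
    (hfin : forall i j, finite_set [set x | mu c m i j x != 0]) :
  [/\ (~` amoeba c m) 0,
      closure (origin_component c m) = setTau c m
    & is_dual_curve (frontier (origin_component c m)) (limit_curve c m)].
Proof.
case: p hp c m hc hsigma hm hA hfin => [//|n] _ c m hc hsigma hm [mgt1 hirr _ _] hfin.
have [s us hs] := mu_support hfin.
have Mirr := Lmu_irreducible hc hsigma hm us hs hirr.
have ME := LmuE hc hsigma hm us hs.
have rho0 : rho c m 0 < 1 := rho0_lt1 hc hsigma hm us hs hirr mgt1.
have conv := expfam_rho_convex (mu_ge0 hc hsigma hm) ME Mirr.
have lt_open := expfam_rho_lt_open ME Mirr.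
have gt_open := expfam_rho_gt_open ME Mirr.
have sub_compact := expfam_sublevel_compact ME Mirr
  (Lmu_diag_ge hc hsigma hm us hs hirr ord0).
have amoeba_ge : [set t | rho c m t < 1] `<=` ~` amoeba c m.
  move=> t /= t1 /(amoeba_rho_ge1 hc hsigma hm us hs hirr).
  by rewrite leNgt t1.
have eq_amoeba : [set t | rho c m t = 1] `<=` amoeba c m.
  by move=> t /(rho_eq1_amoeba hc hsigma hm us hs hirr).
have compE : origin_component c m = [set t | rho c m t < 1].
  exact: (sublevel_component conv rho0 (lt_open 1) (gt_open 1)).
split; first exact: amoeba_ge.
  by rewrite compE; exact: (sublevel_closure conv rho0 (gt_open 1)).
rewrite compE.
exact: (sublevel_is_dual_curve conv rho0 (lt_open 1) (gt_open 1) sub_compact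
  (expfam_rho_gateaux ME Mirr)).
Qed.
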